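(* Let $k$ be a field, let $L_4 = k(x_1,x_2,x_3,x_4)$ be the field of rational functions in four independent variables, let $K_4 = L_4^{\mathrm{PGL}_2}$ be the field of cross-ratios, and let $S$ be a subgroup of the symmetric group $\Sigma_4$, acting on $L_4$ and on $K_4$ by permuting the variables. (a) Assume $S$ is not isomorphic to a cyclic group of order $4$. Then $L_4^S$ is rational over $K_4^S$ for any base field $k$. (b) Assume $S$ is cyclic of order $4$ and $\operatorname{char}(k) \neq 2$. Then $L_4^S$ is rational over $K_4^S$ if and only if $k$ contains a primitive $4$th root of unity. (c) Assume $S$ is cyclic of order $4$ and $\operatorname{char}(k) = 2$. Then $L_4^S$ is rational over $K_4^S$.
   Context: The algebraic group $\mathrm{PGL}_2$ over $k$ acts on $L_4$ via $\begin{pmatrix} a & b \\ c & d\end{pmatrix}\colon x_i \mapsto \dfrac{a x_i + b}{c x_i + d}$ for $i=1,\dots,4$. Invariants are understood with respect to the algebraic group: $L_4^{\mathrm{PGL}_2}$ is the function field of the rational (Rosenlicht) quotient $(\mathbb{P}^1)^4/\mathrm{PGL}_2$ for the diagonal action of $\mathrm{PGL}_2$ on $(\mathbb{P}^1)^4$. Explicitly, $$K_4 = L_4^{\mathrm{PGL}_2} = k\left(\frac{(x_4-x_1)(x_3-x_2)}{(x_4-x_2)(x_3-x_1)}\right).$$ The group $\Sigma_4$ acts on $L_4$ by $k$-automorphisms permuting $x_1,\dots,x_4$; this action restricts to an action on $K_4$. For a subgroup $S\subset\Sigma_4$, $L_4^S$ and $K_4^S$ denote the fixed subfields. A finitely generated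 field extension $L/K$ is called rational if $L$ is purely transcendental over $K$. *)

(* Defs.v *)
From HB Require Import structures.
From mathcomp Require Import all_boot all_order all_algebra all_fingroup all_solvable.
From mathcomp Require Import generic_quotient fraction mpoly.

Set Implicit Arguments.
Unset Strict Implicit.
Unset Printing Implicit Defensive.

Import GRing.Theory.
Local Open Scope ring_scope.

(* The field k(x_1, x_2, x_3, x_4); the variables are indexed by 0, ..., 3. *)
Definition ratfun4 (k : fieldType) : fieldType := {fraction {mpoly k[4]}}.

Definition rvar (k : fieldType) (i : 'I_4) : ratfun4 k :=
  tofrac ('X_i : {mpoly k[4]}).

Definition rconst (k : fieldType) (c : k) : ratfun4 k :=
  tofrac (c%:MP : {mpoly k[4]}).

HB.instance Definition _ (k : fieldType) :=
  GRing.RMorphism.copy (@rconst k) (@tofrac {mpoly k[4]} \o @mpolyC 4 k).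

(* Substitution of v_i for x_i, the coefficients being mapped by iota. The
   chosen representative of f is irrelevant as soon as v is algebraically
   independent over the image of iota (see rsubst_frac), which holds in all the
   uses below. *)
Definition rsubst (k E : fieldType) (iota : {rmorphism k -> E}) (v : 'I_4 -> E)
    (f : ratfun4 k) : E :=
  let pq := generic_quotient.repr (f : {fraction {mpoly k[4]}}) in
  mmap iota v \n_pq / mmap iota v \d_pq.

Lemma rsubst_frac (k E : fieldType) (iota : {rmorphism k -> E}) (v : 'I_4 -> E)
    (v_free : forall p : {mpoly k[4]}, p != 0 -> mmap iota v p != 0)
    (p q : {mpoly k[4]}) :
  q != 0 ->
  rsubst iota v (tofrac p / tofrac q) = mmap iota v p / mmap iota v q.
Proof.
move=> q0; rewrite /rsubst; set f := tofrac p / tofrac q.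
set r := generic_quotient.repr _.
have d0 : \d_r != 0 by apply: denom_ratioP.
have Ef : f = tofrac \n_r / tofrac \d_r.
  rewrite -[LHS]reprK -/r; move: (r) d0 => {}r r0.
  unlock tofrac; rewrite -[X in _ * X]FracField.pi_inv -[RHS]FracField.pi_mul.
  rewrite /FracField.mulf /FracField.invf !numden_Ratio ?oner_neq0 //.
  by rewrite mulr1 mul1r Ratio_numden.
have : f * tofrac q * tofrac \d_r = tofrac p * tofrac \d_r.
  by rewrite /f divfK // tofrac_eq0.
rewrite Ef mulrAC divfK ?tofrac_eq0 // -!tofracM => /eqP.
rewrite tofrac_eq => /eqP /(congr1 (mmap iota v)); rewrite !rmorphM /= => e.
by apply/eqP; rewrite eqr_div ?v_free // e.
Qed.

(* The automorphism of k(x_1, ..., x_4) with x_i |-> x_(s i). *)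
Definition perm_act (k : fieldType) (s : 'S_4) : ratfun4 k -> ratfun4 k :=
  rsubst (@rconst k) (fun i => rvar k (s i)).

(* x_i |-> (a x_i + b) / (c x_i + d) for g = (a b; c d). *)
Definition mobius_act (k : fieldType) (g : 'M[k]_2) : ratfun4 k -> ratfun4 k :=
  rsubst (@rconst k) (fun i =>
    (rconst (g 0 0) * rvar k i + rconst (g 0 1)) /
    (rconst (g 1 0) * rvar k i + rconst (g 1 1))).

Definition base_change (k F : fieldType) (iota : {rmorphism k -> F}) :
    ratfun4 k -> ratfun4 F :=
  rsubst (@rconst F \o iota) (rvar F).

(* Invariants of the algebraic group PGL_2 and not of its group of k-points:
   for finite k, invariance under PGL_2(k) alone would give a larger field, so
   the base change of f must be PGL_2(F)-invariant for all extensions F of k. *)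
Definition PGL2_invariant (k : fieldType) (f : ratfun4 k) : Prop :=
  forall (F : fieldType) (iota : {rmorphism k -> F}) (g : 'M[F]_2),
    g \in unitmx -> mobius_act g (base_change iota f) = base_change iota f.

Definition perm_invariant (k : fieldType) (S : {group 'S_4}) (f : ratfun4 k) :
    Prop :=
  forall s : 'S_4, s \in S -> perm_act s f = f.

Definition L4fix (k : fieldType) (S : {group 'S_4}) : ratfun4 k -> Prop :=
  fun f => perm_invariant S f.

Definition K4fix (k : fieldType) (S : {group 'S_4}) : ratfun4 k -> Prop :=
  fun f => PGL2_invariant f /\ perm_invariant S f.

Arguments L4fix : clear implicits.
Arguments K4fix : clear implicits.

Section Rationality.

Variables (E : fieldType) (K : E -> Prop) (n : nat).

Definition coefs_in (p : {mpoly E[n]}) : Prop := forall m, K p@_m.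

Definition alg_independent (t : 'I_n -> E) : Prop :=
  forall p : {mpoly E[n]}, coefs_in p -> p.@[t] = 0 -> p = 0.

(* Membership in K(t_1, ..., t_n), for a subfield K of E. *)
Definition adjoin (t : 'I_n -> E) (x : E) : Prop :=
  exists p q : {mpoly E[n]},
    [/\ coefs_in p, coefs_in q, q.@[t] != 0 & x = p.@[t] / q.@[t]].

End Rationality.

(* L/K is rational, for subfields K, L of an ambient field E: since rational
   extensions are finitely generated by definition, the transcendence basis
   generating L over K is finite. *)
Definition rational_over (E : fieldType) (L K : E -> Prop) : Prop :=
  exists (n : nat) (t : 'I_n -> E),
    alg_independent K t /\ forall x, L x <-> adjoin K t x.

(* Main.v *)
From HB Require Import structures.
Require Import Defs.
From mathcomp Require Import all_boot all_order all_algebra all_fingroup all_solvable.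
From mathcomp Require Import generic_quotient fraction mpoly.
From mathcomp Require Import boolp ring.
Import Order.TTheory GRing.Theory.

Set Implicit Arguments.
Unset Strict Implicit.
Unset Printing Implicit Defensive.

Local Open Scope ring_scope.

(** Why the theorem holds.  Write E = k(x_0, ..., x_3) and let K4, K5, K6 be
the subfields of E fixed by all homographies, by the affine ones and by the
translations.  The tower K4 < K5 < K6 < E consists of simple transcendental
extensions, whose generators can be chosen as follows.

- E = K6(v) for the barycenter v of the points x_i, weighted by the
  derivatives f'(x_i) of the polynomial f with roots x_i.  The weights are
  equivariant under permutations and their sum is nonzero in every
  characteristic.
- K6 = K5(u) for the spread u, the sum of the x_i - v.
- K5 = K4(y) for an affine ratio y = (x_l - x_j) / (x_l - x_m), which is the
  coordinate of the point at infinity in a frame made of three of the points.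

These facts are in [invariant_tower]; they give in addition that K4 is
generated over k by any cross-ratio.  Both u and v are fixed by all
permutations of the variables, so by Galois descent ([descent]) the
extensions E^S / K6^S and K6^S / K5^S are simple transcendental for every S.
Hence E^S is rational over K4^S as soon as K5^S is a simple transcendental
extension of K4^S.  Geometrically, K5 is the function field over K4 of a
projective line on which the point at infinity varies and which carries the
four marked points x_i; the Klein four-group acts trivially on K4, and K5^S
is the function field of a conic over K4^S, the twisted form of the quotient
of this line by N, the intersection of S with the Klein group.  A rational
point of the conic is what is needed.

If the S-orbit of some index i is also its N-orbit, the image of x_i in the
quotient is such a point.  The corresponding generator of K5^S is explicit:
it is the sum over the orbit of i of functions [pole x j] with one simple
pole, at x_j, which the permutations exchange ([rational_of_orbit]).  Such an
index exists unless S is cyclic of order four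
([klein_orbit_or_cyclic4]).

Now let S be generated by a turn s of order four, exchanging
x_0 -> x_1 -> x_2 -> x_3.  Then K5^N = K4(r) for
r = (x_0 - x_2) / (x_1 - x_3), s maps r to -1/r, and some kappa in K4 is
mapped to its opposite.  If z^2 = -1 in k and 2 is nonzero, then
kappa (r + z) / (r - z) is a generator fixed by s; in characteristic two
there is another one ([rational_of_root], [rational_of_char2]).  Conversely
kappa^2 is always a sum of two squares in E^S, because the quadratic
extension of E^S generated by kappa lies in the cyclic extension E of degree
four ([pythagoras]).  If E^S is rational over K4^S, comparison of leading
coefficients gives a nontrivial identity a^2 + b^2 = kappa^2 c^2 in K4^S,
which is k(kappa^2); a parity argument on degrees in kappa^2 then yields a
square root of -1 in k ([two_squares_free], [two_squares_transc],
[root_of_rational]). *)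

(** * Subfields and simple extensions *)

(** The field A(w).  Subfields are boolean predicates, by classical logic, so
that the closure lemmas for [divringClosed] predicates apply to them. *)
Definition adj (E : fieldType) (A : {pred E}) (w : E) : {pred E} :=
  fun x => `[< exists p q : {poly E}, [/\ p \is a polyOver A,
     q \is a polyOver A, q.[w] != 0 & x = p.[w] / q.[w]] >].

Section Adj.
Variables (E : fieldType) (A : divringClosed E).
Implicit Types (w x : E) (p q : {poly E}).

Lemma adjP w x : reflect
  (exists p q : {poly E}, [/\ p \is a polyOver A, q \is a polyOver A,
     q.[w] != 0 & x = p.[w] / q.[w]]) (x \in adj A w).
Proof. exact: asboolP. Qed.

Lemma horner_adj w p : p \is a polyOver A -> p.[w] \in adj A w.
Proof.
move=> pA; apply/adjP; exists p, 1; split; rewrite ?rpred1 //.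
  by rewrite hornerC oner_neq0.
by rewrite hornerC divr1.
Qed.

Lemma adj_sub w x : x \in A -> x \in adj A w.
Proof. by move=> xA; rewrite -(hornerC x w) horner_adj ?polyOverC. Qed.

Lemma adj_gen w : w \in adj A w.
Proof. by rewrite -[X in X \in _]hornerX horner_adj ?polyOverX. Qed.

Lemma adj_divring w : divring_closed (adj A w).
Proof.
split=> [|x y|x y]; first by rewrite adj_sub ?rpred1.
  move=> /adjP[p [q [pA qA q0 ->]]] /adjP[r [s [rA sA s0 ->]]].
  apply/adjP; exists (p * s - r * q), (q * s).
  split; rewrite ?rpredB ?rpredM //; first by rewrite hornerM mulf_neq0.
  by rewrite hornerM hornerD hornerN !hornerM -mulNr addf_div // mulNr.
move=> /adjP[p [q [pA qA q0 ->]]] /adjP[r [s [rA sA s0 ->]]].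
have [r0|r0] := eqVneq r.[w] 0.
  by rewrite r0 mul0r invr0 mulr0 adj_sub ?rpred0.
apply/adjP; exists (p * s), (q * r); split; rewrite ?rpredM //.
  by rewrite hornerM mulf_neq0.
by rewrite !hornerM; field; rewrite s0 r0 q0.
Qed.

HB.instance Definition _ w :=
  GRing.isDivringClosed.Build E (adj A w) (adj_divring w).
End Adj.

Lemma adj_min (E : fieldType) (A B : divringClosed E) w :
  {subset A <= B} -> w \in B -> {subset adj A w <= B}.
Proof.
move=> AB wB x /adjP[p [q [pA qA _ ->]]].
by rewrite rpred_div // rpred_horner //; apply: polyOverS AB _ _.
Qed.

Lemma map_poly_in (E E' : fieldType) (A : {pred E}) (f g : {rmorphism E -> E'})
    (p : {poly E}) :
  {in A, f =1 g} -> p \is a polyOver A -> map_poly f p = map_poly g p.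
Proof.
move=> fg /allP pA; apply/polyP => i; rewrite !coef_map /=.
have [ltip|leip] := ltnP i (size p); last by rewrite nth_default ?rmorph0.
by rewrite fg //; apply/pA/mem_nth.
Qed.

Lemma adj_agree (E E' : fieldType) (A : {pred E}) w (f g : {rmorphism E -> E'}) :
  {in A, f =1 g} -> f w = g w -> {in adj A w, f =1 g}.
Proof.
move=> fg fw x /asboolP[p [q [pA qA _ ->]]].
by rewrite !fmorph_div -!horner_map fw !(map_poly_in fg).
Qed.

Definition transc (E : fieldType) (A : {pred E}) (w : E) :=
  forall p : {poly E}, p \is a polyOver A -> p.[w] = 0 -> p = 0.

(** Orbit criterion for the transcendence of w over A: morphisms that agree on
A take infinitely many values at w, and all these values would be roots of an
equation of w over A.  The family is recorded, and not only transcendence,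
because [movable_alg] transfers it to other elements. *)
Definition movable (E : fieldType) (A : {pred E}) (w : E) :=
  exists (E' : fieldType) (phi : nat -> {rmorphism E -> E'}),
    (forall n, {in A, phi n =1 phi 0%N}) /\ injective (fun n => phi n w).

Lemma no_infinite_roots (E : fieldType) (q : {poly E}) (f : nat -> E) :
  injective f -> (forall n, root q (f n)) -> q = 0.
Proof.
move=> f_inj f_root; apply: contraTeq isT => q0.
suff: (size (mkseq f (size q)) < size q)%N by rewrite size_mkseq ltnn.
apply: (max_poly_roots q0); last exact: mkseq_uniq.
by apply/allP => _ /mapP[n _ ->].
Qed.

Lemma movable_transc (E : fieldType) (A : {pred E}) w :
  movable A w -> transc A w.
Proof.
case=> [E' [phi [phiA phi_inj]]] p pA pw0; apply/eqP.
rewrite -(map_poly_eq0 (phi 0%N)); apply/eqP.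
apply: (no_infinite_roots phi_inj) => n.
by rewrite -(map_poly_in (phiA n)) // /root horner_map pw0 rmorph0.
Qed.

Lemma finite_roots (E : fieldType) (q : {poly E}) :
  q != 0 -> exists rs : seq E, forall z, root q z -> z \in rs.
Proof.
move=> q0; apply: contrapT => no_rs.
suff /(_ (size q)) [rs [uniq_rs root_rs size_rs]] :
    forall n, exists rs, [/\ uniq rs, all (root q) rs & size rs = n].
  by have := max_poly_roots q0 root_rs uniq_rs; rewrite size_rs ltnn.
elim=> [|n [rs [uniq_rs root_rs size_rs]]]; first by exists [::].
apply: contrapT => no_more; apply: no_rs; exists rs => z qz.
apply: contrapT => /negP z_rs; apply: no_more; exists (z :: rs).
by rewrite /= z_rs qz size_rs.
Qed.

(** An element X over which y is algebraic is transcendental when y is.  If X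
were algebraic, the morphisms phi_n would take finitely many values at X, so
infinitely many of them would agree on A(X); but then the images of y are
infinitely many roots of one polynomial. *)
Lemma movable_alg (E : fieldType) (A : divringClosed E) y X (G : {poly E}) :
  movable A y -> G \is a polyOver (adj A X) -> G != 0 -> G.[y] = 0 ->
  transc A X.
Proof.
move=> [E' [phi [phiA phi_inj]]] GA G0 Gy p pA pX; apply: contrapT => /eqP p0.
have [rs rsP] : exists rs : seq E', forall z, root (map_poly (phi 0%N) p) z -> z \in rs.
  by apply: finite_roots; rewrite map_poly_eq0.
have {rsP} XP n : phi n X \in rs.
  apply: rsP; rewrite -(map_poly_in (phiA n)) // /root horner_map.
  by rewrite pX rmorph0.
(* Infinite pigeonhole: phi n X = z for arbitrarily large n. *)
have [z zP] : exists z, forall b, exists2 n, (b <= n)%N & phi n X = z.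
  apply: contrapT => noz.
  have bound z : exists b, forall n, (b <= n)%N -> phi n X != z.
    apply: contrapT => nob; apply: noz; exists z => b.
    apply: contrapT => non; apply: nob; exists b => n bn.
    by apply: contra_notN non => /eqP; exists n.
  suff [b bP] : exists b, forall n, (b <= n)%N -> phi n X \notin rs.
    by have := bP b (leqnn b); rewrite XP.
  elim: rs {XP} => [|x rs [b bP]]; first by exists 0%N.
  have [c cP] := bound x; exists (maxn b c) => n.
  rewrite geq_max => /andP[bn cn].
  by rewrite inE negb_or cP ?bP.
have [s [uniq_s size_s sz]] : exists s : seq nat,
    [/\ uniq s, size s = size G & forall n, n \in s -> phi n X = z].
  elim: (size G) => [|m [s [uniq_s size_s sz]]]; first by exists [::].
  have [n bn nz] := zP (\max_(i <- s) i).+1; exists (n :: s).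
  rewrite /= size_s; split=> // [|i].
    rewrite uniq_s andbT; apply: contraL bn => ns.
    by rewrite -ltnNge ltnS (bigD1_seq n) //= leq_maxl.
  by rewrite inE => /predU1P[->|/sz].
case: s uniq_s size_s sz => [|n0 s] uniq_s size_s sz.
  by move/esym/eqP: size_s; rewrite /= size_poly_eq0 (negPf G0).
have eqG n : n \in n0 :: s -> map_poly (phi n) G = map_poly (phi n0) G.
  move=> ns; apply: map_poly_in GA; apply: adj_agree => [x xA|].
    by rewrite phiA // [RHS]phiA.
  by rewrite !sz ?mem_head.
have G0' : map_poly (phi n0) G != 0 by rewrite map_poly_eq0.
suff: (size [seq phi n y | n <- n0 :: s] < size (map_poly (phi n0) G))%N.
  by rewrite size_map size_s size_map_poly ltnn.
apply: (max_poly_roots G0').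
  by apply/allP => _ /mapP[n ns ->]; rewrite -(eqG n) // /root horner_map Gy rmorph0.
by rewrite map_inj_uniq.
Qed.

Lemma mem_of_scale (E : fieldType) (A : divringClosed E) f (p q : {poly E}) :
  p \is a polyOver A -> q \is a polyOver A -> q != 0 -> f *: q = p -> f \in A.
Proof.
move=> /polyOverP pA /polyOverP qA q0 fq.
have -> : f = p`_(size q).-1 / lead_coef q.
  by rewrite -fq coefZ -lead_coefE mulfK // lead_coef_eq0.
by rewrite lead_coefE rpred_div.
Qed.

Lemma transc_sub (E : fieldType) (A B : {pred E}) w :
  {subset A <= B} -> transc B w -> transc A w.
Proof. by move=> AB wB p pA; apply/wB/(polyOverS AB). Qed.

Lemma transc_notin (E : fieldType) (A : divringClosed E) w a :
  transc A w -> a \in A -> w != a.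
Proof.
move=> wA aA; rewrite -subr_eq0; apply/eqP => wa.
have /eqP : 'X - a%:P = 0 :> {poly E}.
  by apply: wA; rewrite ?polyOverXsubC ?hornerXsubC.
by rewrite polyXsubC_eq0.
Qed.

Lemma transc_neq_fraction (E : fieldType) (A : divringClosed E) w r b c :
  transc A w -> r \in A -> b \in A -> c \in A -> w != r ->
  w != b + c / (w - r).
Proof.
move=> wA rA bA cA wr; apply/eqP => e.
have : ('X - b%:P) * ('X - r%:P) - c%:P = 0 :> {poly E}.
  apply: wA; first by rewrite rpredB ?rpredM ?polyOverXsubC ?polyOverC.
  rewrite hornerD hornerN hornerM !hornerXsubC hornerC.
  have -> : w - b = c / (w - r) by rewrite {1}e addrAC subrr add0r.
  by rewrite divfK ?subrr // subr_eq0.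
move/eqP; rewrite subr_eq0 => /eqP/(congr1 (fun p : {poly E} => size p)).
rewrite size_monicM ?monicXsubC ?polyXsubC_eq0 // !size_XsubC => sC.
by have := size_polyC_leq1 c; rewrite -sC.
Qed.

Lemma movable_affine (E : fieldType) (A : {pred E}) a b w :
  a \in A -> b \in A -> a != 0 -> movable A w -> movable A (a * w + b).
Proof.
move=> aA bA a0 [E' [phi [phiA phi_inj]]]; exists E', phi; split=> // n m.
rewrite !rmorphD !rmorphM (phiA n) // (phiA n b) // (phiA m) // (phiA m b) //.
by move=> /addIr/mulfI e; apply: phi_inj; apply: e; rewrite fmorph_eq0.
Qed.

(** Computes an invariant field B from a known subfield A of it: if f in B is
P(w) / Q(w) with P and Q over A, then f Q - P vanishes at w, hence is zero,
and f is a quotient of coefficients. *)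
Lemma sandwich (E : fieldType) (A B : divringClosed E) w :
  {subset A <= B} -> {subset B <= adj A w} -> transc B w -> {subset B <= A}.
Proof.
move=> AB BA wB f fB; have /adjP[p [q [pA qA qw e]]] := BA _ fB.
have q0 : q != 0 by apply: contraNneq qw => ->; rewrite horner0.
apply: (mem_of_scale pA qA q0); apply/eqP; rewrite -subr_eq0; apply/eqP/wB.
  by rewrite rpredB ?polyOverZ // (polyOverS AB).
by rewrite hornerD hornerN hornerZ e divfK ?subrr.
Qed.

Lemma reduce_poly (E : fieldType) (M : divringClosed E) (G : {poly E}) y p :
  G \is a polyOver M -> G \is monic -> G.[y] = 0 -> p \is a polyOver M ->
  exists r : {poly E}, [/\ r \is a polyOver M, (size r < size G)%N & r.[y] = p.[y]].
Proof.
move=> GM Gm Gy; have G0 := monic_neq0 Gm.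
elim/poly_ind: p => [|q c IH] qM.
  by exists 0; rewrite rpred0 size_poly0 size_poly_gt0.
have /IH[r [rM sr ry]] : q \is a polyOver M.
  apply/polyOverP => i; have /polyOverP/(_ i.+1) := qM.
  by rewrite coefD coefMX coefC addr0.
have cM : c \in M.
  by have /polyOverP/(_ 0) := qM; rewrite coefD coefMX coefC add0r.
set h := r * 'X + c%:P.
have hM : h \is a polyOver M by rewrite rpredD ?rpredM ?polyOverX ?polyOverC.
have sh : (size h <= size G)%N.
  rewrite size_MXaddC; case: ifP => // _; exact: (leq_trans (leqnSn _)).
exists (h - h`_(size G).-1 *: G); split.
- by rewrite rpredB ?polyOverZ //; apply: (polyOverP hM).
- rewrite -[X in (_ < X)%N](prednK) ?size_poly_gt0 // ltnS.
  apply/leq_sizeP => j; rewrite leq_eqVlt => /predU1P[<-|ltj].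
    by rewrite coefB coefZ -lead_coefE (monicP Gm) mulr1 subrr.
  have leGj : (size G <= j)%N by apply: leq_trans (leqSpred _) ltj.
  by rewrite coefB coefZ !(nth_default _ leGj)
    (nth_default _ (leq_trans sh leGj)) mulr0 subrr.
- by rewrite !hornerE Gy mulr0 subr0 ry.
Qed.

(** Artin's argument, in the form: an element f of M(y) fixed by as many
automorphisms as the degree of y lies in M.  With f = P(y) / Q(y) reduced
modulo G, each conjugate of y is a root of f Q - P, whose degree is
smaller than the number of conjugates. *)
Lemma fixed_simple_ext (E : fieldType) (M : divringClosed E) (G : {poly E}) y
    (I : eqType) (act : I -> {rmorphism E -> E}) (ns : seq I) f :
  G \is a polyOver M -> G \is monic -> G.[y] = 0 -> size G = (size ns).+1 ->
  (forall n, n \in ns -> {in M, act n =1 id} /\ act n f = f) ->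
  uniq [seq act n y | n <- ns] -> f \in adj M y -> f \in M.
Proof.
move=> GM Gm Gy sG actP uniq_y /adjP[p [q [pM qM qy e]]].
have [p' [p'M sp p'y]] := reduce_poly GM Gm Gy pM.
have [q' [q'M sq q'y]] := reduce_poly GM Gm Gy qM.
have q'0 : q' != 0 by apply: contraNneq qy => q0; rewrite -q'y q0 horner0.
apply: (mem_of_scale p'M q'M q'0); apply/eqP; rewrite -subr_eq0.
apply: contraT => h0; set h := _ - _ in h0.
suff: (size [seq act n y | n <- ns] < size h)%N.
  rewrite sG !ltnS in sp sq; rewrite size_map ltnNge => /negP[].
  rewrite (leq_trans (size_polyD _ _)) // size_polyN geq_max sp andbT.
  exact: leq_trans (size_scale_leq _ _) sq.
apply: (max_poly_roots h0 _ uniq_y).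
apply/allP => _ /mapP[n nns ->]; have [nM nf] := actP n nns.
have fixM (r : {poly E}) : r \is a polyOver M -> r.[act n y] = act n r.[y].
  move=> rM; rewrite -horner_map; congr (_.[_]); apply/polyP => i.
  by rewrite coef_map /= nM // (polyOverP rM).
rewrite /root /h hornerD hornerN hornerZ !fixM // p'y q'y -[X in X * _]nf.
by rewrite -rmorphM e divfK // subrr.
Qed.

(** The equation says that X = y + sum of (b_j + c_j / (y - r_j)), with
b = X - sum of b_j: a function of y with simple poles at infinity and at the
r_j.  The degree of y over the field of X is then the number of poles. *)
Lemma partial_fraction_poly (E : fieldType) (M : divringClosed E) (I : eqType)
    (o : seq I) (r c : I -> E) b y :
  uniq o -> (forall j, j \in o -> r j \in M /\ c j \in M) -> b \in M ->
  (forall j, j \in o -> y != r j) ->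
  y - b + \sum_(j <- o) c j / (y - r j) = 0 ->
  exists G : {poly E}, [/\ G \is a polyOver M, G \is monic,
    size G = (size o).+2 & G.[y] = 0].
Proof.
move=> uniq_o rcM bM y_r ye.
pose D (s : seq I) := \prod_(j <- s) ('X - (r j)%:P).
have DM (s : seq I) : {subset s <= o} -> D s \is a polyOver M.
  move=> so; rewrite /D big_seq rpred_prod // => j /so/rcM[rM _].
  by rewrite polyOverXsubC.
have sub_rem j : {subset rem j o <= o} by apply: mem_rem.
pose L := ('X - b%:P) * D o; pose T := \sum_(j <- o) c j *: D (rem j o).
have sL : size L = (size o).+2.
  by rewrite size_monicM ?monicXsubC ?monic_neq0 ?monic_prod_XsubC //
     size_XsubC size_prod_XsubC addnS.
have sT : (size T < size L)%N.
  rewrite sL ltnS; apply: (leq_trans (size_sum _ _ _)).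
  apply/bigmax_leqP_seq => j jo _; apply: (leq_trans (size_scale_leq _ _)).
  by rewrite size_prod_XsubC ltnS size_rem // leq_pred.
exists (L + T); split.
- rewrite rpredD ?rpredM ?polyOverXsubC ?DM //.
  rewrite /T big_seq rpred_sum // => j jo; rewrite polyOverZ ?DM //.
  by have [] := rcM j jo.
- rewrite monicE lead_coefDl // -monicE monicMl ?monicXsubC //.
  exact: monic_prod_XsubC.
- by rewrite size_polyDl.
- rewrite hornerD hornerM hornerXsubC horner_sum.
  transitivity ((y - b + \sum_(j <- o) c j / (y - r j)) * (D o).[y]); last first.
    by rewrite ye mul0r.
  rewrite [RHS]mulrDl; congr (_ + _).
  rewrite mulr_suml big_seq [RHS]big_seq; apply: eq_bigr => j jo.
  rewrite hornerZ [in RHS]/D (big_rem j) //= hornerM hornerXsubC.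
  by rewrite mulrA divfK // subr_eq0 y_r.
Qed.

(** * Descent along a finite group *)

Definition fixp (E : fieldType) (A : {pred E}) (gT : finGroupType)
    (act : gT -> {rmorphism E -> E}) (S : {group gT}) : {pred E} :=
  fun x => (x \in A) && `[< forall s, s \in S -> act s x = x >].

Section Descent.
Variables (E : fieldType) (A : divringClosed E) (gT : finGroupType).
Variables (act : gT -> {rmorphism E -> E}) (S : {group gT}).

Lemma fixpP x : reflect (x \in A /\ forall s, s \in S -> act s x = x)
  (x \in fixp A act S).
Proof. by apply: (iffP andP) => -[xA /asboolP]. Qed.

Lemma fixp_divring : divring_closed (fixp A act S).
Proof.
split=> [|x y /fixpP[xA xS] /fixpP[yA yS]|x y /fixpP[xA xS] /fixpP[yA yS]];
  apply/fixpP; split=> [|s sS].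
- exact: rpred1.
- exact: rmorph1.
- exact: rpredB.
- by rewrite rmorphB xS ?yS.
- exact: rpred_div.
- by rewrite fmorph_div xS ?yS.
Qed.

HB.instance Definition _ :=
  GRing.isDivringClosed.Build E (fixp A act S) fixp_divring.

(** Galois descent of a generator w.  For x = P(w) / Q(w), multiplying by the
conjugates of Q makes the denominator invariant; the numerator is then
invariant at w, hence coefficientwise because w is transcendental. *)
Lemma descent w x :
  (forall y, act 1%g y = y) ->
  (forall s t y, act s (act t y) = act (t * s)%g y) ->
  (forall s y, s \in S -> y \in A -> act s y \in A) ->
  (forall s, s \in S -> act s w = w) ->
  transc A w ->
  x \in adj A w -> (forall s, s \in S -> act s x = x) ->
  x \in adj (fixp A act S) w.
Proof.
move=> act1 actM SA Sw wA /adjP[p [q [pA qA qw e]]] Sx.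
pose r := \prod_(s in S) map_poly (act s) q.
have SpolyA s (h : {poly E}) : s \in S -> h \is a polyOver A ->
    map_poly (act s) h \is a polyOver A.
  move=> sS /polyOverP hA; apply/polyOverP => i.
  by rewrite coef_map SA.
have actw s (h : {poly E}) : s \in S -> (map_poly (act s) h).[w] = act s h.[w].
  by move=> sS; rewrite -[X in _.[X]](Sw s sS) horner_map.
have act_inv t (h : {poly E}) : t \in S -> h \is a polyOver A ->
    act t h.[w] = h.[w] -> map_poly (act t) h = h.
  move=> tS hA th; apply/eqP; rewrite -subr_eq0; apply/eqP/wA.
    by rewrite rpredB ?SpolyA.
  by rewrite hornerD hornerN actw // th subrr.
have polyF (h : {poly E}) : h \is a polyOver A ->
    (forall t, t \in S -> map_poly (act t) h = h) ->
    h \is a polyOver (fixp A act S).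
  move=> hA hS; apply/polyOverP => i; apply/fixpP; split=> [|t tS].
    exact: (polyOverP hA).
  by rewrite -[in RHS](hS t tS) coef_map.
have r1 : r = q * \prod_(s in S | s != 1%g) map_poly (act s) q.
  rewrite /r (bigD1 1%g) //=; congr (_ * _).
  by rewrite map_poly_id // => c _; apply: act1.
set r' := \prod_(_ in _ | _) _ in r1.
have r'A : r' \is a polyOver A.
  by apply: rpred_prod => s /andP[sS _]; apply: SpolyA.
have rA : r \is a polyOver A by rewrite r1 rpredM.
have rS t : t \in S -> map_poly (act t) r = r.
  move=> tS; rewrite /r rmorph_prod /=.
  rewrite [RHS](reindex_inj (mulIg t)) /=.
  apply: eq_big => [s|s _]; first by rewrite groupMr.
  by rewrite -map_poly_comp; apply: eq_map_poly => c /=; rewrite actM.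
have rw : r.[w] != 0.
  rewrite horner_prod; apply/prodf_neq0 => s sS.
  by rewrite actw // fmorph_eq0.
have xr : (p * r').[w] = x * r.[w].
  by rewrite r1 !hornerM e mulrA divfK.
apply/adjP; exists (p * r'), r; split=> //.
- apply: polyF => [|t tS]; first exact: rpredM.
  apply: act_inv => //; first exact: rpredM.
  by rewrite xr rmorphM Sx // -actw // rS.
- exact: polyF.
- by rewrite xr mulfK.
Qed.
End Descent.

(** * Towers of purely transcendental extensions *)

Section Tower.
Variable E : fieldType.
Implicit Types A B C : divringClosed E.

Notation rational B A := (rational_over (fun x => x \in B) (fun x => x \in A)).

Lemma coefs_inP A n (p : {mpoly E[n]}) :
  coefs_in (fun x => x \in A) p <-> p \is a mpolyOver n A.
Proof. by split=> [pA|/mpolyOverP//]; apply/mpolyOverP. Qed.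

(** [adjoin] as a boolean predicate, to be used as a subfield. *)
Definition madj A n (t : 'I_n -> E) : {pred E} :=
  fun x => `[< adjoin (fun x => x \in A) t x >].

Lemma madjP A n (t : 'I_n -> E) x : reflect
  (exists p q : {mpoly E[n]}, [/\ p \is a mpolyOver n A,
     q \is a mpolyOver n A, q.@[t] != 0 & x = p.@[t] / q.@[t]])
  (x \in madj A t).
Proof.
apply: (iffP (asboolP _)) => -[p [q [pA qA q0 e]]]; exists p, q; split=> //;
  exact/coefs_inP.
Qed.

Lemma madj_divring A n (t : 'I_n -> E) : divring_closed (madj A t).
Proof.
split=> [|x y|x y].
- apply/madjP; exists 1, 1; split; rewrite ?rpred1 ?meval1 ?oner_neq0 //.
  by rewrite divr1.
- move=> /madjP[p [q [pA qA q0 ->]]] /madjP[r [s [rA sA s0 ->]]].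
  apply/madjP; exists (p * s - r * q), (q * s).
  split; rewrite ?rpredB ?rpredM //; first by rewrite mevalM mulf_neq0.
  by rewrite mevalB !mevalM -mulNr addf_div // mulNr.
- move=> /madjP[p [q [pA qA q0 ->]]] /madjP[r [s [rA sA s0 ->]]].
  have [r0|r0] := eqVneq r.@[t] 0.
    rewrite r0 mul0r invr0 mulr0; apply/madjP; exists 0, 1.
    by split; rewrite ?rpred0 ?rpred1 ?meval1 ?meval0 ?oner_neq0 ?mul0r.
  apply/madjP; exists (p * s), (q * r); split; rewrite ?rpredM //.
    by rewrite mevalM mulf_neq0.
  by rewrite !mevalM; field; rewrite s0 r0 q0.
Qed.

HB.instance Definition _ A n (t : 'I_n -> E) :=
  GRing.isDivringClosed.Build E (madj A t) (@madj_divring A n t).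

Lemma rational_refl A : rational A A.
Proof.
have t0 : 'I_0 -> E by case.
exists 0%N, t0; split.
  move=> p _; have -> : p = (p@_0)%:MP.
    apply/mpolyP => m; rewrite mcoeffC.
    have -> : m = 0%MM by apply/mnmP => -[].
    by rewrite eqxx mulr1.
  by rewrite mevalC => ->; rewrite mpolyC0.
move=> x; split=> [xA|].
  exists x%:MP, 1; split; rewrite ?meval1 ?mevalC ?oner_neq0 ?divr1 //.
    by apply/coefs_inP; rewrite mpolyOverC.
  by apply/coefs_inP; rewrite rpred1.
case=> p [q [/coefs_inP pA /coefs_inP qA _ ->]].
by rewrite rpred_div // rpred_mhorner //; apply/forallP; case.
Qed.

Definition snoc n (t : 'I_n -> E) (w : E) (i : 'I_n.+1) : E :=
  if unlift ord_max i is Some j then t j else w.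

Lemma snoc_max n (t : 'I_n -> E) w : snoc t w ord_max = w.
Proof. by rewrite /snoc unlift_none. Qed.

Lemma snoc_widen n (t : 'I_n -> E) w i :
  snoc t w (widen_ord (leqnSn n) i) = t i.
Proof.
rewrite /snoc; have -> : widen_ord (leqnSn n) i = lift ord_max i.
  by apply/val_inj; rewrite /= /bump leqNgt ltn_ord.
by rewrite liftK.
Qed.

Lemma meval_snoc n (t : 'I_n -> E) w (p : {mpoly E[n.+1]}) :
  p.@[snoc t w] = (map_poly (meval t) (muni p)).[w].
Proof.
rewrite muniE mevalE rmorph_sum horner_sum /=; apply: eq_bigr => m _.
rewrite map_polyZ map_polyXn /= hornerZ hornerXn mevalZ mevalX.
rewrite -mulrA big_ord_recr /= snoc_max; congr (_ * (_ * _)).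
by apply: eq_bigr => i _; rewrite snoc_widen mnmE.
Qed.

Lemma muni_inj n (p : {mpoly E[n.+1]}) : muni p = 0 -> p = 0.
Proof.
move=> p0; apply/mpolyP => m; rewrite mcoeff0.
pose r (m : 'X_{1..n.+1}) : 'X_{1..n} :=
  [multinom [tuple m (widen_ord (leqnSn n) i) : nat | i < n]].
have <- : (muni p)`_(m ord_max)@_(r m) = p@_m.
  rewrite muniE coef_sum raddf_sum /=.
  rewrite (eq_bigr (fun m' => if m' == m then p@_m' else 0)); last first.
    move=> m' _; rewrite coefZ coefXn; have [->|neq] := eqVneq m' m.
      by rewrite eqxx mulr1 mcoeffZ mcoeffX eqxx mulr1.
    have [eq_max|] := eqVneq (m ord_max) (m' ord_max); last first.
      by rewrite mulr0 mcoeff0.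
    rewrite mulr1 mcoeffZ mcoeffX; case: eqP => [eq_r|]; last by rewrite mulr0.
    case/eqP: neq; apply/mnmP => i; case: (unliftP ord_max i) => [j ->|->] //.
    have -> : lift ord_max j = widen_ord (leqnSn n) j.
      by apply/val_inj; rewrite /= /bump leqNgt ltn_ord.
    by have /mnmP/(_ j) := eq_r; rewrite !mnmE.
  have [mp|mp] := boolP (m \in msupp p).
    rewrite (bigD1_seq m) ?msupp_uniq //= eqxx big1 ?addr0 // => m' /negPf.
    by move=> ->.
  rewrite (memN_msupp_eq0 mp) big_seq big1 // => m' m'p.
  by case: eqP mp => // <-; rewrite m'p.
by rewrite p0 coef0 mcoeff0.
Qed.

Lemma madj_base A n (t : 'I_n -> E) : {subset A <= madj A t}.
Proof.
move=> x xA; apply/madjP; exists x%:MP, 1; rewrite meval1 mevalC divr1.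
by split; rewrite ?mpolyOverC ?rpred1 ?oner_neq0.
Qed.

Lemma madj_var A n (t : 'I_n -> E) i : t i \in madj A t.
Proof.
apply/madjP; exists 'X_i, 1; rewrite meval1 mevalXU divr1.
by split; rewrite ?mpolyOverX ?rpred1 ?oner_neq0.
Qed.

Lemma madj_min A B n (t : 'I_n -> E) :
  {subset A <= B} -> (forall i, t i \in B) -> {subset madj A t <= B}.
Proof.
move=> AB tB x /madjP[p [q [pA qA _ ->]]].
by rewrite rpred_div // rpred_mhorner ?(mpolyOverS AB) //; apply/forallP.
Qed.

(** Adds a generator w at the top of a rational extension B / A.  A relation in
n + 1 variables over A is read as a polynomial relation of w, whose
coefficients are relations of the n generators of B. *)
Lemma rational_step A B C w :
  {subset A <= B} -> {subset B <= C} -> {subset C <= adj B w} -> w \in C ->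
  transc B w -> rational B A -> rational C A.
Proof.
move=> AB BC CB wC wB [n [t [t_free Bt]]].
have tB i : t i \in B by apply/Bt/asboolP/madj_var.
exists n.+1, (snoc t w); split=> [p /coefs_inP/mpolyOverP pA|x].
  rewrite meval_snoc => pw.
  have muniA i : (muni p)`_i \is a mpolyOver n A.
    rewrite muniE coef_sum rpred_sum // => m _.
    rewrite coefZ coefXn rpredM ?rpred_nat //.
    by rewrite mpolyOverZ ?mpolyOverX.
  have p0 : map_poly (meval t) (muni p) = 0.
    apply: wB pw; apply/polyOverP => i; rewrite coef_map.
    apply: (rpred_mhorner (mpolyOverS AB (muniA i))).
    by apply/forallP.
  apply: muni_inj; apply/polyP => i; rewrite coef0; apply: t_free.
    exact/coefs_inP.
  by have /polyP/(_ i) := p0; rewrite coef_map coef0.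
have tC i : snoc t w i \in C.
  by rewrite /snoc; case: unliftP => // j _; apply: BC.
split=> [xC|/asboolP]; last first.
  by apply: madj_min tC x => y /AB/BC.
suff: x \in madj A (snoc t w) by move=> /asboolP.
apply: adj_min (CB _ xC).
  move=> y yB; have /asboolP : adjoin (fun x => x \in A) t y by apply/Bt.
  apply: madj_min => [|i]; first exact: madj_base.
  by rewrite -(snoc_widen t w) madj_var.
by rewrite -[X in X \in _](snoc_max t) madj_var.
Qed.

End Tower.

(** * Substitutions in rational functions *)

Lemma ratfunP (k : fieldType) (f : ratfun4 k) :
  exists p q : {mpoly k[4]}, q != 0 /\ f = tofrac p / tofrac q.
Proof.
set r := generic_quotient.repr (f : {fraction {mpoly k[4]}}).
have d0 : \d_r != 0 by apply: denom_ratioP.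
exists \n_r, \d_r; split=> //.
rewrite -[LHS]reprK -/r; move: (r) d0 => {}r r0.
unlock tofrac; rewrite -[X in _ * X]FracField.pi_inv -[RHS]FracField.pi_mul.
rewrite /FracField.mulf /FracField.invf !numden_Ratio ?oner_neq0 //.
by rewrite mulr1 mul1r Ratio_numden.
Qed.

Lemma tofrac_mmap (k : fieldType) (p : {mpoly k[4]}) :
  tofrac p = mmap (@rconst k) (rvar k) p.
Proof.
rewrite {1}[p]mpolyE raddf_sum; apply: eq_bigr => m _ /=.
rewrite -mul_mpolyC rmorphM; congr (_ * _).
by rewrite mpolyXE_id rmorph_prod; apply: eq_bigr => i _; rewrite rmorphXn.
Qed.

Lemma ratfun_gen (k : fieldType) (B : divringClosed (ratfun4 k)) :
  (forall c, rconst c \in B) -> (forall i, rvar k i \in B) ->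
  forall f, f \in B.
Proof.
move=> Bc Bx; have Bp p : tofrac p \in B.
  rewrite tofrac_mmap rpred_sum // => m _; rewrite rpredM ?Bc //.
  by apply: rpred_prod => i _; rewrite rpredX.
by move=> f; have [p [q [_ ->]]] := ratfunP f; rewrite rpred_div.
Qed.

Lemma ratfun_morph_ext (k E : fieldType) (f g : {rmorphism ratfun4 k -> E}) :
  (forall c, f (rconst c) = g (rconst c)) ->
  (forall i, f (rvar k i) = g (rvar k i)) -> f =1 g.
Proof.
move=> fgc fgx; have fgp p : f (tofrac p) = g (tofrac p).
  rewrite tofrac_mmap !rmorph_sum; apply: eq_bigr => m _.
  rewrite !rmorphM fgc; congr (_ * _); rewrite !rmorph_prod.
  by apply: eq_bigr => i _; rewrite !rmorphXn fgx.
by move=> x; have [p [q [_ ->]]] := ratfunP x; rewrite !fmorph_div !fgp.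
Qed.

Section FreeSubstitution.
Variables (k E : fieldType) (iota : {rmorphism k -> E}) (v : 'I_4 -> E).

Definition free_subst := forall p : {mpoly k[4]}, p != 0 -> mmap iota v p != 0.

(** Carries the proof of freeness in its type, for the morphism instances. *)
Definition rsubst_of & free_subst : ratfun4 k -> E := rsubst iota v.

Hypothesis v_free : free_subst.

Lemma rsubst_tofrac p : rsubst iota v (tofrac p) = mmap iota v p.
Proof.
have := rsubst_frac v_free p (oner_neq0 {mpoly k[4]}).
by rewrite tofrac1 divr1 rmorph1 divr1.
Qed.

Fact rsubst_of_zmod : zmod_morphism (rsubst_of v_free).
Proof.
move=> x y; have [p [q [q0 ->]]] := ratfunP x; have [r [s [s0 ->]]] := ratfunP y.
rewrite /rsubst_of -mulNr addf_div ?tofrac_eq0 // -rmorphN -!rmorphM -rmorphD.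
rewrite !rsubst_frac ?mulf_neq0 // !(rmorphD, rmorphM, rmorphN) /=.
by rewrite -[in RHS]mulNr addf_div ?v_free.
Qed.

Fact rsubst_of_monoid : monoid_morphism (rsubst_of v_free).
Proof.
split=> [|x y]; first by rewrite /rsubst_of -tofrac1 rsubst_tofrac rmorph1.
have [p [q [q0 ->]]] := ratfunP x; have [r [s [s0 ->]]] := ratfunP y.
rewrite /rsubst_of mulf_div -!rmorphM !rsubst_frac ?mulf_neq0 // !rmorphM /=.
by rewrite mulf_div.
Qed.

HB.instance Definition _ :=
  GRing.isZmodMorphism.Build (ratfun4 k) E (rsubst_of v_free) rsubst_of_zmod.
HB.instance Definition _ :=
  GRing.isMonoidMorphism.Build (ratfun4 k) E (rsubst_of v_free)
    rsubst_of_monoid.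

Lemma rsubst_var i : rsubst iota v (rvar k i) = v i.
Proof. by rewrite rsubst_tofrac mmapX mmap1U. Qed.

Lemma rsubst_const c : rsubst iota v (rconst c) = iota c.
Proof. by rewrite rsubst_tofrac mmapC. Qed.

Lemma free_rmorphism : exists phi : {rmorphism ratfun4 k -> E},
  [/\ phi =1 rsubst iota v, forall i, phi (rvar k i) = v i &
     forall c, phi (rconst c) = iota c].
Proof.
by exists (rsubst_of v_free); split; [|exact: rsubst_var|exact: rsubst_const].
Qed.
End FreeSubstitution.

(** A substitution v is free when it has an inverse substitution w.  No
morphism is available before freeness is known, so the proof evaluates
fractions by hand: [spec x y] says that x is represented by a fraction whose
denominator does not vanish at w and whose value at w is y.  This relation is
compatible with the ring operations, and relates p(v) to p. *)
Lemma free_invertible (k : fieldType) (v w : 'I_4 -> ratfun4 k)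
    (P Q : 'I_4 -> {mpoly k[4]}) (ev := mmap (@rconst k) w) :
  (forall i, v i = tofrac (P i) / tofrac (Q i)) ->
  (forall i, ev (Q i) != 0) -> (forall i, ev (P i) / ev (Q i) = rvar k i) ->
  free_subst (@rconst k) v.
Proof.
move=> vE Q0 PQ p; apply: contraNneq => p0.
pose spec (x y : ratfun4 k) := exists N D : {mpoly k[4]},
  [/\ ev D != 0, x = tofrac N / tofrac D & y = ev N / ev D].
have tofrac_neq0 D : ev D != 0 -> tofrac D != 0.
  by rewrite tofrac_eq0; apply: contraNneq => ->; rewrite /ev mmap0.
have evD a b : ev (a + b) = ev a + ev b by apply: rmorphD.
have evM a b : ev (a * b) = ev a * ev b by apply: rmorphM.
have specD x x' y y' : spec x y -> spec x' y' -> spec (x + x') (y + y').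
  move=> [N [D [D0 -> ->]]] [N' [D' [D0' -> ->]]].
  exists (N * D' + N' * D), (D * D'); split.
  - rewrite evM; exact: mulf_neq0 D0 D0'.
  - by rewrite rmorphD !rmorphM (addf_div _ _ (tofrac_neq0 _ D0) (tofrac_neq0 _ D0')).
  - by rewrite evD !evM (addf_div _ _ D0 D0').
have specM x x' y y' : spec x y -> spec x' y' -> spec (x * x') (y * y').
  move=> [N [D [D0 -> ->]]] [N' [D' [D0' -> ->]]].
  exists (N * N'), (D * D'); split.
  - rewrite evM; exact: mulf_neq0 D0 D0'.
  - by rewrite !rmorphM mulf_div.
  - by rewrite !evM mulf_div.
have specC c : spec (rconst c) (rconst c).
  by exists c%:MP, 1; rewrite /ev rmorph1 mmapC !divr1 oner_neq0.
have specP : spec (mmap (@rconst k) v p) (tofrac p).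
  rewrite tofrac_mmap; apply: (big_ind2 spec).
  - by have := specC 0; rewrite rmorph0.
  - by move=> ? ? ? ?; apply: (specD).
  move=> m _; apply: (specM); first exact: specC.
  apply: (big_ind2 spec).
  - by have := specC 1; rewrite rmorph1.
  - by move=> ? ? ? ?; apply: (specM).
  move=> i _; elim: (m i) => [|n IH].
    by have := specC 1; rewrite rmorph1 !expr0.
  by rewrite !exprS; apply: (specM) => //; exists (P i), (Q i); rewrite PQ.
have [N [D [D0 e1 e2]]] := specP.
rewrite -tofrac_eq0 e2; move: e1; rewrite p0 => /esym/eqP.
rewrite mulf_eq0 invr_eq0 (negPf (tofrac_neq0 _ D0)) orbF tofrac_eq0 => /eqP->.
by rewrite /ev mmap0 mul0r.
Qed.

Lemma perm_free (k : fieldType) (s : 'S_4) :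
  free_subst (@rconst k) (fun i => rvar k (s i)).
Proof.
apply: (@free_invertible _ _ (fun i => rvar k ((s^-1)%g i))
          (fun i => 'X_(s i)) (fun=> 1)) => i.
- by rewrite rmorph1 divr1.
- by rewrite rmorph1 oner_neq0.
- by rewrite rmorph1 divr1 mmapX mmap1U permK.
Qed.

HB.instance Definition _ (k : fieldType) (s : 'S_4) :=
  GRing.RMorphism.copy (@perm_act k s) (rsubst_of (@perm_free k s)).

Lemma perm_act_var (k : fieldType) (s : 'S_4) i :
  perm_act s (rvar k i) = rvar k (s i).
Proof. exact: (rsubst_var (@perm_free k s)). Qed.

Lemma perm_act_const (k : fieldType) (s : 'S_4) (c : k) :
  perm_act s (rconst c) = rconst c.
Proof. exact: (rsubst_const (@perm_free k s)). Qed.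

Lemma perm_act1 (k : fieldType) (f : ratfun4 k) : perm_act 1%g f = f.
Proof.
apply: (ratfun_morph_ext (f := perm_act 1%g) (g := idfun)) => [c|i] /=.
  by rewrite perm_act_const.
by rewrite perm_act_var perm1.
Qed.

Lemma perm_actM (k : fieldType) (s t : 'S_4) (f : ratfun4 k) :
  perm_act s (perm_act t f) = perm_act (t * s)%g f.
Proof.
apply: (ratfun_morph_ext (f := perm_act s \o perm_act t)) => [c|i] /=.
  by rewrite !perm_act_const.
by rewrite !perm_act_var permM.
Qed.

Lemma linear_neq0 (k : fieldType) (a b : k) i :
  ~~ ((a == 0) && (b == 0)) -> rconst a + rconst b * rvar k i != 0.
Proof.
rewrite /rconst /rvar -rmorphM -rmorphD tofrac_eq0; apply: contra => /eqP e.
have := congr1 (mcoeff 0%MM) e; have := congr1 (mcoeff U_(i)%MM) e.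
rewrite !(mcoeffD, mcoeffCM, mcoeffC, mcoeffX, mcoeff0) mnm1_eq0 !eqxx mulr0.
by rewrite !(mulr1, mulr0, mul0r, addr0, add0r) => -> ->; rewrite eqxx.
Qed.

Lemma unitmx2P (k : fieldType) (g : 'M[k]_2) :
  (g \in unitmx) = (g 0 0 * g 1 1 - g 0 1 * g 1 0 != 0).
Proof.
rewrite unitmxE unitfE (expand_det_row _ 0) !big_ord_recl big_ord0 addr0.
rewrite /cofactor !det_mx11 !mxE /= expr0 expr1 mul1r mulN1r mulrN.
have -> : lift 0 0 = 1 :> 'I_2 by apply/val_inj.
have -> : lift 1 0 = 0 :> 'I_2 by apply/val_inj.
by have -> : ord0 = 0 :> 'I_2 by apply/val_inj.
Qed.

Fact mobius_inverse_den (K : fieldType) (a b c d x : K) : a - c * x != 0 ->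
  c * ((d * x - b) / (a - c * x)) + d = (a * d - b * c) / (a - c * x).
Proof. by move=> h; field. Qed.

Fact mobius_inverse_num (K : fieldType) (a b c d x : K) :
  a - c * x != 0 -> a * d - b * c != 0 ->
  (a * ((d * x - b) / (a - c * x)) + b) / ((a * d - b * c) / (a - c * x)) = x.
Proof. by move=> h1 h2; field; rewrite h1 h2. Qed.

Lemma mobius_free (k : fieldType) (g : 'M[k]_2) : g \in unitmx ->
  free_subst (@rconst k) (fun i =>
    (rconst (g 0 0) * rvar k i + rconst (g 0 1)) /
    (rconst (g 1 0) * rvar k i + rconst (g 1 1))).
Proof.
rewrite unitmx2P => det0.
have den0 i : rconst (g 0 0) - rconst (g 1 0) * rvar k i != 0.
  rewrite -mulNr -rmorphN linear_neq0 //; apply: contra det0 => /andP[/eqP->].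
  by rewrite oppr_eq0 => /eqP->; rewrite mulr0 mul0r subr0.
pose w i := (rconst (g 1 1) * rvar k i - rconst (g 0 1)) /
  (rconst (g 0 0) - rconst (g 1 0) * rvar k i).
have detE : rconst (g 0 0) * rconst (g 1 1) - rconst (g 0 1) * rconst (g 1 0) != 0.
  by rewrite -!rmorphM -rmorphB fmorph_eq0.
have denE i : rconst (g 1 0) * w i + rconst (g 1 1) =
    (rconst (g 0 0) * rconst (g 1 1) - rconst (g 0 1) * rconst (g 1 0)) /
    (rconst (g 0 0) - rconst (g 1 0) * rvar k i).
  by rewrite /w (mobius_inverse_den _ _ (den0 i)).
apply: (@free_invertible _ _ w (fun i => (g 0 0)%:MP * 'X_i + (g 0 1)%:MP)
          (fun i => (g 1 0)%:MP * 'X_i + (g 1 1)%:MP)) => i.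
- by rewrite !rmorphD !rmorphM.
- rewrite !rmorphD !rmorphM /= !mmapC mmapX mmap1U denE.
  by apply: mulf_neq0 detE _; rewrite invr_eq0; apply: den0.
- rewrite !rmorphD !rmorphM /= !mmapC mmapX mmap1U denE /w.
  by rewrite (mobius_inverse_num (den0 i) detE).
Qed.

Lemma base_change_free (k F : fieldType) (iota : {rmorphism k -> F}) :
  free_subst (@rconst F \o iota) (rvar F).
Proof.
move=> p p0; have -> : mmap (@rconst F \o iota) (rvar F) p =
    tofrac (map_mpoly iota p).
  rewrite /map_mpoly /mmap rmorph_sum; apply: eq_bigr => m _.
  rewrite rmorphM; congr (_ * _); rewrite /mmap1 rmorph_prod.
  by apply: eq_bigr => i _; rewrite rmorphXn.
rewrite tofrac_eq0; apply: contraNneq p0 => p0; apply/eqP/mpolyP => m.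
have /(congr1 (mcoeff m))/eqP := p0.
by rewrite mcoeff_map_mpoly !mcoeff0 fmorph_eq0 => /eqP.
Qed.

Lemma mobius_morph (k F : fieldType) (iota : {rmorphism k -> F}) (g : 'M[F]_2) :
  g \in unitmx ->
  exists phi : {rmorphism ratfun4 k -> ratfun4 F},
    [/\ phi =1 mobius_act g \o base_change iota,
        forall i, phi (rvar k i) = (rconst (g 0 0) * rvar F i + rconst (g 0 1)) /
                               (rconst (g 1 0) * rvar F i + rconst (g 1 1)) &
        forall c, phi (rconst c) = rconst (iota c)].
Proof.
move=> gU; have [f [fE fx fc]] := free_rmorphism (mobius_free gU).
have [b [bE bx bc]] := free_rmorphism (base_change_free iota).
exists (f \o b); split=> [x|i|c] /=; first by rewrite fE bE.
  by rewrite bx fx.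
by rewrite bc fc.
Qed.

(** Shifting a single variable is not a homography: it moves the cross-ratio,
and shows that it is transcendental over k. *)
Lemma shift_morph (k F : fieldType) (iota : {rmorphism k -> F}) (b : F) (j : 'I_4) :
  exists phi : {rmorphism ratfun4 k -> ratfun4 F},
    (forall i, phi (rvar k i) = rvar F i + rconst (b *+ (i == j))) /\
    (forall c, phi (rconst c) = rconst (iota c)).
Proof.
have sh_free : free_subst (@rconst F)
    (fun i => rvar F i + rconst (b *+ (i == j))).
  apply: (@free_invertible _ _ (fun i => rvar F i - rconst (b *+ (i == j)))
            (fun i => 'X_i + (b *+ (i == j))%:MP) (fun=> 1)) => i.
  - by rewrite rmorph1 divr1 rmorphD.
  - by rewrite rmorph1 oner_neq0.
  - by rewrite rmorph1 divr1 rmorphD /= mmapX mmap1U mmapC subrK.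
have [f [fE fx fc]] := free_rmorphism sh_free.
have [h [hE hx hc]] := free_rmorphism (base_change_free iota).
exists (f \o h); split=> [i|c] /=; first by rewrite hx fx.
by rewrite hc fc.
Qed.

(** * Fields of invariants *)

(** A condition on 2 x 2 matrices over every field, which selects a subgroup of
the algebraic group of homographies. *)
Definition mx_class := forall F : fieldType, pred 'M[F]_2.

(** Invariance is tested over all extensions of k: the group of points over a
finite field k has too many invariants. *)
Definition Ginv (k : fieldType) (Gamma : mx_class) : {pred ratfun4 k} :=
  fun f => `[< forall (F : fieldType) (iota : {rmorphism k -> F}) (g : 'M[F]_2),
    g \in unitmx -> Gamma F g ->
    mobius_act g (base_change iota f) = base_change iota f >].

(** Invariance of f in terms of any ring morphisms that take the prescribed
values on the variables, which can be built and composed freely. *)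
Lemma Ginv_morphP (k : fieldType) (Gamma : mx_class) (f : ratfun4 k) : reflect
  (forall (F : fieldType) (iota : {rmorphism k -> F}) (g : 'M[F]_2)
     (phi psi : {rmorphism ratfun4 k -> ratfun4 F}),
     g \in unitmx -> Gamma F g ->
     (forall i, phi (rvar k i) = (rconst (g 0 0) * rvar F i + rconst (g 0 1)) /
                             (rconst (g 1 0) * rvar F i + rconst (g 1 1))) ->
     (forall c, phi (rconst c) = rconst (iota c)) ->
     (forall i, psi (rvar k i) = rvar F i) ->
     (forall c, psi (rconst c) = rconst (iota c)) ->
     phi f = psi f)
  (f \in Ginv Gamma).
Proof.
apply: (iffP (asboolP _)) => [fG F iota g phi psi gU gG phix phic psix psic|fG].
  have [a [aE ax ac]] := mobius_morph iota gU.
  have [b [bE bx bc]] := free_rmorphism (base_change_free iota).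
  rewrite (ratfun_morph_ext (f := phi) (g := a)) => [|c|i]; last 2 first.
  - by rewrite phic ac.
  - by rewrite phix ax.
  rewrite (ratfun_morph_ext (f := psi) (g := b)) => [|c|i]; last 2 first.
  - by rewrite psic bc.
  - by rewrite psix bx.
  by rewrite aE bE; apply: fG.
move=> F iota g gU gG; have [a [aE ax ac]] := mobius_morph iota gU.
have [b [bE bx bc]] := free_rmorphism (base_change_free iota).
by rewrite -[LHS]aE -[RHS]bE; apply: (fG F iota g).
Qed.

Lemma Ginv_divring (k : fieldType) Gamma : divring_closed (Ginv (k := k) Gamma).
Proof.
split=> [|x y /Ginv_morphP xG /Ginv_morphP yG|x y /Ginv_morphP xG /Ginv_morphP yG];
  apply/Ginv_morphP => F iota g a b gU gG ax ac bx bc.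
- by rewrite !rmorph1.
- by rewrite !rmorphB (xG F iota g a b) // (yG F iota g a b).
- by rewrite !fmorph_div (xG F iota g a b) // (yG F iota g a b).
Qed.

HB.instance Definition _ (k : fieldType) Gamma :=
  GRing.isDivringClosed.Build (ratfun4 k) (Ginv Gamma)
    (@Ginv_divring k Gamma).

Lemma Ginv_const (k : fieldType) Gamma (c : k) : rconst c \in Ginv Gamma.
Proof.
by apply/Ginv_morphP => F iota g a b gU gG ax ac bx bc; rewrite ac bc.
Qed.

Definition all_mx : mx_class := fun=> predT.
Definition affine_mx : mx_class := fun F g => g 1 0 == 0.
Definition translation_mx : mx_class :=
  fun F g => [&& g 1 0 == 0, g 0 0 == 1 & g 1 1 == 1].

Lemma PGL2_invariantE (k : fieldType) (f : ratfun4 k) :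
  PGL2_invariant f <-> f \in Ginv all_mx.
Proof.
split=> [fG|/asboolP fG F iota g gU]; last exact: fG.
by apply/asboolP => F iota g gU _; apply: fG.
Qed.

Ltac in_subfield :=
  rewrite ?(rpred_div, rpredM, rpredD, rpredN, rpredX, rpred1, rpred_nat) //.

(** * Four points on the affine line *)

Definition quad (j l m p : 'I_4) := uniq [:: j; l; m; p].

Lemma quadE j l m p : quad j l m p ->
  ((l != j) * (m != j) * (p != j) * (m != l) * (p != l) * (p != m)) *
  ((j != l) * (j != m) * (j != p) * (l != m) * (l != p) * (m != p)).
Proof.
rewrite /quad /= !inE !negb_or.
case/and4P=> /and3P[a b c] /andP[d e] f _.
by rewrite a b c d e f ![_ == j]eq_sym [m == l]eq_sym ![p == _]eq_sym a b c d e f.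
Qed.

Lemma quad_cover j l m p i : quad j l m p -> i \in [:: j; l; m; p].
Proof.
move=> q; have [||_ ->] := uniq_min_size (s1 := [:: j; l; m; p]) (s2 := enum 'I_4) q.
  by move=> ? _; rewrite mem_enum.
  by rewrite size_enum_ord.
by rewrite mem_enum.
Qed.

Lemma big_quad2 (R : Type) (idx : R) (op : Monoid.com_law idx) (F : 'I_4 -> R)
    j l m p : quad j l m p ->
  \big[op/idx]_(i | (i != j) && (i != l)) F i = op (F m) (F p).
Proof.
move=> q; rewrite (bigD1 m) ?(quadE q) //= (bigD1 p) ?(quadE q) //=.
rewrite big_pred0 ?Monoid.mulm1 // => i; have := quad_cover i q.
by rewrite !inE => /or4P[] /eqP->; rewrite eqxx ?andbF.
Qed.

Lemma big_quad3 (R : Type) (idx : R) (op : Monoid.com_law idx) (F : 'I_4 -> R)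
    j l m p : quad j l m p ->
  \big[op/idx]_(i | i != j) F i = op (F l) (op (F m) (F p)).
Proof.
by move=> q; rewrite (bigD1 l) ?(quadE q) //= (big_quad2 _ _ q).
Qed.

Lemma quad_exists (j l : 'I_4) : j != l -> exists m p, quad j l m p.
Proof.
move=> jl; have : (1 < #|[pred i | (i != j) && (i != l)]|)%N.
  have := cardC (pred2 j l); rewrite card_ord card2 jl.
  have -> : #|[predC pred2 j l]| = #|[pred i | (i != j) && (i != l)]|.
    by apply: eq_card => i; rewrite !inE negb_or.
  by move=> /eqP; rewrite eqn_add2l => /eqP->.
case/card_gt1P=> m [p [/andP[mj ml] /andP[pj pl] mp]]; exists m, p.
rewrite /quad /= !inE !negb_or jl ![j == _]eq_sym ![l == _]eq_sym.
by rewrite mj pj ml pl mp.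
Qed.

(** The derivative at x_i of the polynomial with roots x_l.  Over rings, so
that it can be evaluated on polynomials. *)
Definition weight (R : comNzRingType) (x : 'I_4 -> R) i :=
  \prod_(l | l != i) (x i - x l).
Definition total_weight (R : comNzRingType) (x : 'I_4 -> R) := \sum_i weight x i.

Section Coordinates.
Variables (E : fieldType) (x : 'I_4 -> E).
Local Notation weight := (weight x).
Local Notation total_weight := (total_weight x).

(** Weights f'(x_i) instead of equal ones: equal weights have sum 4, which
vanishes in characteristic two. *)
Definition barycenter := (\sum_i x i * weight i) / total_weight.
(** A symmetric, translation invariant element of degree one. *)
Definition spread := \sum_i (x i - barycenter).

(** In the coordinate u = 1 / (x - x_j), which sends x_j to infinity, this is
(u_m - u_p) / (u_m - u_l), and [affine_ratio j l m] is u_m / (u_m - u_l),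
where 0 is the image of infinity. *)
Definition cross_ratio j l m p :=
  (x p - x m) * (x l - x j) / ((x p - x j) * (x l - x m)).

Definition affine_ratio j l m := (x l - x j) / (x l - x m).

Definition recip j i := (x i - x j)^-1.
(** As a function of the point at infinity, an element with a simple pole at
x_j that depends symmetrically on the three other points.  In the coordinate
u = 1 / (x - x_j), and with g the cubic with roots u_m, it is the quotient of
the sum of the u_m g'(u_m) by the product of the 3 u_m - (sum of the u_l).
The numerator is affine in a common translation of the u_m and the denominator
is invariant under it, and both are homogeneous of degree three. *)
Definition pole j :=
  (\sum_(m | m != j) recip j m *
     \prod_(l | (l != j) && (l != m)) (recip j m - recip j l)) /
  \prod_(m | m != j) \sum_(l | l != j) (recip j m - recip j l).

Hypothesis x_inj : injective x.

Lemma subx_neq0 i j : i != j -> x i - x j != 0.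
Proof. by rewrite subr_eq0 (inj_eq x_inj). Qed.

Lemma affine_ratio_swap j l i : i != j -> l != j -> l != i ->
  affine_ratio i l j * affine_ratio j l i = 1.
Proof. by move=> ij lj li; rewrite /affine_ratio; field; rewrite !subx_neq0. Qed.

(** With u_m = d y, u_l = d (y - 1) and u_p = d (y - r), the powers of d
cancel in [pole] and what is left is affine in y. *)
Lemma pole_affine_ratio (A : divringClosed E) j l m p (r := cross_ratio j l m p) :
  quad j l m p -> r \in A ->
  r + 1 != 0 -> r - 2 != 0 -> 1 - 2 * r != 0 -> r ^+ 2 - r + 1 != 0 ->
  exists a b, [/\ a \in A, b \in A, a != 0 & pole j = a * affine_ratio j l m + b].
Proof.
move=> q rA r1 r2 r3 r4; set y := affine_ratio j l m.
pose d := recip j m - recip j l.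
have [lj mj pj] : [/\ x l - x j != 0, x m - x j != 0 & x p - x j != 0].
  by split; rewrite subx_neq0 // (quadE q).
have [ml pl pm] : [/\ x l - x m != 0, x p - x l != 0 & x p - x m != 0].
  by split; rewrite subx_neq0 // (quadE q).
have d0 : d != 0.
  have -> : d = (x l - x m) / ((x m - x j) * (x l - x j)).
    by rewrite /d /recip; field; rewrite lj mj.
  by rewrite mulf_neq0 ?invr_eq0 ?mulf_neq0.
have em : recip j m = d * y.
  by rewrite /y /affine_ratio /d /recip; field; rewrite ml mj lj.
have el : recip j l = d * (y - 1).
  by rewrite /y /affine_ratio /d /recip; field; rewrite ml mj lj.
have ep : recip j p = d * (y - r).
  by rewrite /y /affine_ratio /d /recip /r /cross_ratio; field; rewrite ml mj lj pj.
clearbody r.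
exists ((r ^+ 2 - r + 1) / ((r + 1) * (r - 2) * (1 - 2 * r))).
exists ((r - 1) * (1 - r ^+ 2) / ((r + 1) * (r - 2) * (1 - 2 * r))).
split.
- by in_subfield.
- by in_subfield.
- by rewrite mulf_neq0 // invr_eq0 !mulf_neq0.
have q2 : quad j m l p.
  by rewrite /quad /= !inE !negb_or !(quadE q).
have q3 : quad j p l m.
  by rewrite /quad /= !inE !negb_or !(quadE q).
rewrite /pole !(big_quad3 _ _ q) /= (big_quad2 _ _ q) (big_quad2 _ _ q2).
rewrite (big_quad2 _ _ q3) /= el em ep; field.
rewrite r1 r2 r3 /=; apply/and3P; split.
- by rewrite (_ : _ + _ = d * (1 - 2 * r)) ?mulf_neq0 //; ring.
- by rewrite (_ : _ + _ = d * (r + 1)) ?mulf_neq0 //; ring.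
- by rewrite (_ : _ + _ = d * (r - 2)) ?mulf_neq0 //; ring.
Qed.

Lemma ratio_in (A : divringClosed E) j l m p (y := affine_ratio j l m) i i' :
  quad j l m p -> cross_ratio j l m p \in A ->
  (x i - x i') / (x m - x j) \in adj A y.
Proof.
move=> q rA.
have [lj mj pj] : [/\ x l - x j != 0, x m - x j != 0 & x p - x j != 0].
  by split; rewrite subx_neq0 // (quadE q).
have [ml pl pm] : [/\ x l - x m != 0, x p - x l != 0 & x p - x m != 0].
  by split; rewrite subx_neq0 // (quadE q).
have el : (x l - x j) / (x m - x j) = y / (y - 1).
  have -> : y - 1 = (x m - x j) / (x l - x m) by rewrite /y /affine_ratio; field.
  by rewrite /y /affine_ratio; field; rewrite mj ml.
have ep : (x p - x j) / (x m - x j) = y / (y - cross_ratio j l m p).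
  have -> : y - cross_ratio j l m p =
      (x m - x j) * (x l - x j) / ((x l - x m) * (x p - x j)).
    by rewrite /y /affine_ratio /cross_ratio; field; rewrite ml pj.
  by rewrite /y /affine_ratio; field; rewrite ml mj lj pj.
have yB : y \in adj A y by apply: adj_gen.
have rB : cross_ratio j l m p \in adj A y by apply: adj_sub.
move: (cross_ratio j l m p) ep rB => r ep rB; clearbody y.
suff Hj a : (x a - x j) / (x m - x j) \in adj A y.
  have -> : (x i - x i') / (x m - x j) =
    (x i - x j) / (x m - x j) - (x i' - x j) / (x m - x j) by ring.
  by rewrite rpredB.
have := quad_cover a q; rewrite !inE => /or4P[] /eqP->.
- by rewrite subrr mul0r rpred0.
- by rewrite el; in_subfield.
- by rewrite divff // rpred1.
- by rewrite ep; in_subfield.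
Qed.

Lemma spread_total_weight : total_weight != 0 ->
  spread * total_weight =
  (\sum_i x i) * total_weight - 4 * \sum_i x i * weight i.
Proof.
move=> T0; rewrite /spread sumrB sumr_const card_ord -[barycenter *+ 4]mulr_natl mulrBl.
by rewrite -mulrA /barycenter divfK.
Qed.

Lemma weight_scale i c : c != 0 ->
  weight i / c ^+ 3 = \prod_(l | l != i) ((x i - x l) / c).
Proof.
move=> c0; rewrite prodf_div prodr_const; congr (_ / _ ^+ _).
by have := cardC1 i; rewrite card_ord /= => ->.
Qed.

(** All quantities are divided by c = x_m - x_j, to be made affine invariant
and thus elements of A(y); the spread gives back c, the barycenter x_i. *)
Lemma coords_in (A : divringClosed E) j l m p i :
  quad j l m p -> cross_ratio j l m p \in A -> total_weight != 0 -> spread != 0 ->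
  x i \in adj (adj (adj A (affine_ratio j l m)) spread) barycenter.
Proof.
move=> q rA T0 S0; set B := adj A _.
pose c := x m - x j; have c0 : c != 0 by rewrite subx_neq0 // (quadE q).
have dB a b : (x a - x b) / c \in B by apply: ratio_in q rA.
have wB a : weight a / c ^+ 3 \in B.
  by rewrite weight_scale // rpred_prod.
have TB : total_weight / c ^+ 3 \in B by rewrite mulr_suml rpred_sum.
have vB a : (x a - barycenter) / c \in B.
  have -> : (x a - barycenter) / c =
      (\sum_b (x a - x b) / c * (weight b / c ^+ 3)) / (total_weight / c ^+ 3).
    have -> : \sum_b (x a - x b) / c * (weight b / c ^+ 3) =
        (x a * total_weight - \sum_b x b * weight b) / c ^+ 4.
      rewrite mulr_sumr -sumrB mulr_suml; apply: eq_bigr => b _.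
      by field.
    by rewrite /barycenter; field; rewrite c0 T0.
  by rewrite rpred_div // rpred_sum // => b _; rewrite rpredM.
have SB : spread / c \in B by rewrite mulr_suml rpred_sum.
have cB : c \in adj B spread.
  have -> : c = spread / (spread / c) by field; rewrite c0 S0.
  by rewrite rpred_div ?adj_gen // adj_sub.
rewrite -(subrK barycenter (x i)) rpredD ?adj_gen // adj_sub //.
by rewrite -(divfK c0 (x i - barycenter)) rpredM // adj_sub.
Qed.
End Coordinates.

Lemma weight_comp (E : fieldType) (x : 'I_4 -> E) (s : 'S_4) i :
  weight (x \o s) i = weight x (s i).
Proof.
rewrite /weight [RHS](reindex_inj (@perm_inj _ s)).
by apply: eq_bigl => l /=; rewrite (inj_eq perm_inj).
Qed.

Lemma barycenter_comp (E : fieldType) (x : 'I_4 -> E) (s : 'S_4) :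
  barycenter (x \o s) = barycenter x.
Proof.
rewrite /barycenter /total_weight; congr (_ / _).
  rewrite [RHS](reindex_inj (@perm_inj _ s)).
  by apply: eq_bigr => i _; rewrite weight_comp.
rewrite [RHS](reindex_inj (@perm_inj _ s)).
by apply: eq_bigr => i _; rewrite weight_comp.
Qed.

Lemma spread_comp (E : fieldType) (x : 'I_4 -> E) (s : 'S_4) :
  spread (x \o s) = spread x.
Proof.
rewrite /spread barycenter_comp [RHS](reindex_inj (@perm_inj _ s)).
exact: eq_bigr.
Qed.

Lemma pole_comp (E : fieldType) (x : 'I_4 -> E) (s : 'S_4) j :
  pole (x \o s) j = pole x (s j).
Proof.
have sE i l : (s i != s l) = (i != l) by rewrite (inj_eq perm_inj).
rewrite /pole; congr (_ / _).
  rewrite [RHS](reindex_inj (@perm_inj _ s)); apply: eq_big => m; rewrite ?sE //.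
  move=> _; congr (_ * _); rewrite [RHS](reindex_inj (@perm_inj _ s)).
  by apply: eq_bigl => l; rewrite !sE.
rewrite [RHS](reindex_inj (@perm_inj _ s)); apply: eq_big => m; rewrite ?sE //.
move=> _; rewrite [RHS](reindex_inj (@perm_inj _ s)).
by apply: eq_bigl => l; rewrite sE.
Qed.

Lemma weight_morph (R R' : comNzRingType) (f : {rmorphism R -> R'}) x i :
  f (weight x i) = weight (f \o x) i.
Proof. by rewrite rmorph_prod; apply: eq_bigr => l _; rewrite rmorphB. Qed.

Lemma total_weight_morph (R R' : comNzRingType) (f : {rmorphism R -> R'}) x :
  f (total_weight x) = total_weight (f \o x).
Proof. by rewrite rmorph_sum; apply: eq_bigr => i _; rewrite weight_morph. Qed.

Section CoordinateMorphism.
Variables (E E' : fieldType) (f : {rmorphism E -> E'}) (x : 'I_4 -> E).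

Lemma affine_ratio_morph j l m : f (affine_ratio x j l m) = affine_ratio (f \o x) j l m.
Proof. by rewrite fmorph_div !rmorphB. Qed.

Lemma cross_ratio_morph j l m p :
  f (cross_ratio x j l m p) = cross_ratio (f \o x) j l m p.
Proof. by rewrite fmorph_div !rmorphM !rmorphB. Qed.

Lemma barycenter_morph : f (barycenter x) = barycenter (f \o x).
Proof.
rewrite /barycenter fmorph_div total_weight_morph rmorph_sum; congr (_ / _).
by apply: eq_bigr => i _; rewrite rmorphM weight_morph.
Qed.

Lemma spread_morph : f (spread x) = spread (f \o x).
Proof.
by rewrite rmorph_sum; apply: eq_bigr => i _; rewrite rmorphB barycenter_morph.
Qed.

Lemma pole_morph j : f (pole x j) = pole (f \o x) j.
Proof.
have re m : f (recip x j m) = recip (f \o x) j m.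
  by rewrite fmorphV rmorphB.
rewrite /pole fmorph_div rmorph_sum rmorph_prod; congr (_ / _).
  apply: eq_bigr => m _; rewrite rmorphM re; congr (_ * _).
  by rewrite rmorph_prod; apply: eq_bigr => l _; rewrite rmorphB !re.
apply: eq_bigr => m _; rewrite rmorph_sum.
by apply: eq_bigr => l _; rewrite rmorphB !re.
Qed.
End CoordinateMorphism.

Section AffineChange.
Variables (E : fieldType) (x z : 'I_4 -> E) (a b : E).
Hypotheses (a0 : a != 0) (zE : forall i, z i = a * x i + b).

Lemma weight_affine i : weight z i = a ^+ 3 * weight x i.
Proof.
have -> : a ^+ 3 = \prod_(l | l != i) a.
  rewrite prodr_const; congr (_ ^+ _).
  by have := cardC1 i; rewrite card_ord /= => ->.
by rewrite -big_split; apply: eq_bigr => l _; rewrite !zE /=; ring.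
Qed.

Lemma total_weight_affine : total_weight z = a ^+ 3 * total_weight x.
Proof. by rewrite mulr_sumr; apply: eq_bigr => i _; rewrite weight_affine. Qed.

Lemma barycenter_affine : total_weight x != 0 -> barycenter z = a * barycenter x + b.
Proof.
move=> T0; rewrite /barycenter total_weight_affine.
have -> : \sum_i z i * weight z i =
    a ^+ 3 * (a * (\sum_i x i * weight x i) + b * total_weight x).
  rewrite mulrDr !mulr_sumr -big_split; apply: eq_bigr => i _ /=.
  by rewrite zE weight_affine; ring.
by field; rewrite T0 a0.
Qed.

Lemma spread_affine : total_weight x != 0 -> spread z = a * spread x.
Proof.
move=> T0; rewrite mulr_sumr; apply: eq_bigr => i _.
by rewrite barycenter_affine // zE; ring.
Qed.

Lemma affine_ratio_affine j l m : affine_ratio z j l m = affine_ratio x j l m.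
Proof.
rewrite /affine_ratio !zE.
have e i i' : a * x i + b - (a * x i' + b) = a * (x i - x i') by ring.
by rewrite !e -mulf_div divff // mul1r.
Qed.
End AffineChange.

Section MobiusChange.
Variables (E : fieldType) (x z : 'I_4 -> E) (a b c d : E).
Hypotheses (det0 : a * d - b * c != 0) (den0 : forall i, c * x i + d != 0).
Hypothesis zE : forall i, z i = (a * x i + b) / (c * x i + d).

Lemma sub_mobius i i' : z i - z i' =
  (a * d - b * c) * (x i - x i') / ((c * x i + d) * (c * x i' + d)).
Proof. by rewrite !zE; field; rewrite !den0. Qed.

Lemma cross_ratio_mobius j l m p : x p - x j != 0 -> x l - x m != 0 ->
  cross_ratio z j l m p = cross_ratio x j l m p.
Proof.
move=> pj lm; rewrite /cross_ratio !sub_mobius; field.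
by rewrite pj lm !den0 det0.
Qed.

Lemma affine_ratio_mobius j l m : x l - x m != 0 ->
  affine_ratio z j l m = affine_ratio x j l m * ((c * x m + d) / (c * x j + d)).
Proof.
move=> lm; rewrite /affine_ratio !sub_mobius; field.
by rewrite lm !den0 det0.
Qed.
End MobiusChange.

(** * The tower of invariant fields *)

Section Points.
Variable k : fieldType.
Local Notation x := (rvar k).

Lemma mpoly_eval_neq0 (p : {mpoly k[4]}) (v : 'I_4 -> k) :
  p.@[v] != 0 -> (tofrac p : ratfun4 k) != 0.
Proof. by rewrite tofrac_eq0; apply: contraNneq => ->; rewrite meval0. Qed.

Lemma rvar_inj : injective x.
Proof.
move=> i j /eqP; rewrite tofrac_eq => /eqP e; apply/eqP.
have := congr1 (mcoeff U_(i)%MM) e.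
rewrite !mcoeffX eqxx; case: (U_(j)%MM =P U_(i)%MM) => [eU _|_ /eqP].
  by have /mnmP/(_ i) := eU; rewrite !mnm1E eqxx eq_sym; case: eqP.
by rewrite oner_eq0.
Qed.

Definition point2 (a b : k) (i : 'I_4) : k :=
  if val i is 0 then a else if val i is 1 then b else 0.

Lemma weight_point2 a b (v := point2 a b) :
  [/\ weight v 0 = a ^+ 2 * (a - b), weight v 1 = b ^+ 2 * (b - a) &
     forall i : 'I_4, (1 < i)%N -> weight v i = 0].
Proof.
pose i2 : 'I_4 := Ordinal (isT : (2 < 4)%N).
pose i3 : 'I_4 := Ordinal (isT : (3 < 4)%N).
have [v0 v1 v2 v3] : [/\ v 0 = a, v 1 = b, v i2 = 0 & v i3 = 0] by split.
split.
- rewrite /weight (big_quad3 _ _ (_ : quad 0 1 i2 i3)) //= v0 v1 v2 v3; ring.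
- rewrite /weight (big_quad3 _ _ (_ : quad 1 0 i2 i3)) //= v0 v1 v2 v3; ring.
- case=> -[|[|[|[|i]]]] // Hi _.
    rewrite (_ : Ordinal Hi = i2); last exact: val_inj.
    by rewrite /weight (big_quad3 _ _ (_ : quad i2 i3 0 1)) //= v2 v3 subrr mul0r.
  rewrite (_ : Ordinal Hi = i3); last exact: val_inj.
  by rewrite /weight (big_quad3 _ _ (_ : quad i3 i2 0 1)) //= v2 v3 subrr mul0r.
Qed.

Lemma sum_point2 (f : 'I_4 -> k) :
  (forall i : 'I_4, (1 < i)%N -> f i = 0) -> \sum_i f i = f 0 + f 1.
Proof.
move=> f0; rewrite (bigD1 0) //= (bigD1 1) //= big1 ?addr0 // => i.
by move=> /andP[]; case: i => -[|[|i]] // Hi _ _; apply: f0.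
Qed.

Lemma total_weight_point2 a b : total_weight (point2 a b) = (a - b) ^+ 2 * (a + b).
Proof.
have [w0 w1 w2] := weight_point2 a b.
by rewrite /total_weight sum_point2 // w0 w1; ring.
Qed.

Lemma total_weight_neq0 : total_weight x != 0.
Proof.
have -> : total_weight x = tofrac (total_weight (fun i => 'X_i : {mpoly k[4]})).
  by rewrite total_weight_morph.
apply: (@mpoly_eval_neq0 _ (point2 1 0)); rewrite total_weight_morph.
rewrite (_ : total_weight _ = total_weight (point2 1 0)).
  by rewrite total_weight_point2 subr0 addr0 expr1n mulr1 oner_neq0.
by congr total_weight; apply/funext => i /=; rewrite mevalXU.
Qed.

Definition spread_num (R : comNzRingType) (y : 'I_4 -> R) :=
  (\sum_i y i) * total_weight y - 4 * \sum_i y i * weight y i.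

Lemma spread_num_morph (R R' : comNzRingType) (f : {rmorphism R -> R'}) y :
  f (spread_num y) = spread_num (f \o y).
Proof.
rewrite /spread_num rmorphB !rmorphM total_weight_morph !rmorph_sum rmorph_nat.
by congr (_ - _ * _); apply: eq_bigr => i _; rewrite rmorphM weight_morph.
Qed.

Lemma spread_num_point2 a b : spread_num (point2 a b) =
  (a - b) ^+ 2 * (- 3 * a ^+ 2 - 2 * a * b - 3 * b ^+ 2).
Proof.
have [w0 w1 w2] := weight_point2 a b.
rewrite /spread_num total_weight_point2 sum_point2; last by case=> -[|[|?]].
rewrite sum_point2 => [|i i1]; last by rewrite w2 // mulr0.
by rewrite w0 w1; rewrite /point2 /=; ring.
Qed.

(** The numerator takes the value -3 at (1, 0, 0, 0) and -16 at (1, -1, 0, 0),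
which do not both vanish. *)
Lemma spread_neq0 : spread x != 0.
Proof.
have N0 (a b : k) : (a - b) ^+ 2 * (- 3 * a ^+ 2 - 2 * a * b - 3 * b ^+ 2) != 0 ->
    spread x != 0.
  rewrite -spread_num_point2 => N0.
  apply: contraTneq (mpoly_eval_neq0
    (p := spread_num (fun i => 'X_i : {mpoly k[4]})) (v := point2 a b) _) => [S0|].
    rewrite negbK spread_num_morph -[spread_num _]spread_total_weight.
    - by rewrite S0 mul0r.
    - exact: total_weight_neq0.
  rewrite spread_num_morph (_ : _ \o _ = point2 a b) //.
  by apply/funext => i /=; rewrite mevalXU.
have [three0|three] := eqVneq (3 : k) 0.
  apply: (N0 1 (-1)).
  have -> : (1 - (-1)) ^+ 2 * (- 3 * 1 ^+ 2 - 2 * 1 * (-1) - 3 * (-1) ^+ 2) =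
    - 1 - 5 * 3 :> k by ring.
  by rewrite three0 mulr0 subr0 oppr_eq0 oner_neq0.
apply: (N0 1 0).
have -> : (1 - 0) ^+ 2 * (- 3 * 1 ^+ 2 - 2 * 1 * 0 - 3 * 0 ^+ 2) = - 3 :> k.
  by ring.
by rewrite oppr_eq0.
Qed.

Definition kconst : {pred ratfun4 k} := fun f => `[< exists c, f = rconst c >].

Lemma kconst_divring : divring_closed kconst.
Proof.
split=> [|_ _ /asboolP[a ->] /asboolP[b ->]|_ _ /asboolP[a ->] /asboolP[b ->]];
  apply/asboolP.
- by exists 1; rewrite rmorph1.
- by exists (a - b); rewrite rmorphB.
- by exists (a / b); rewrite fmorph_div.
Qed.
HB.instance Definition _ :=
  GRing.isDivringClosed.Build (ratfun4 k) kconst kconst_divring.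

Lemma rconst_in c : rconst c \in kconst.
Proof. by apply/asboolP; exists c. Qed.

End Points.

Section Movable.
Variable k : fieldType.
Local Notation x := (rvar k).

(** The one-parameter groups of homographies must have infinitely many points,
also when k is finite. *)
Lemma infinite_extension : exists (F : fieldType) (iota : {rmorphism k -> F})
  (t : nat -> F), injective t /\ forall n, t n != 0.
Proof.
exists {fraction {poly k}}, (@tofrac {poly k} \o polyC : {rmorphism k -> _}),
  (fun n => @tofrac {poly k} 'X^n).
split=> [n m /eqP|n]; last by rewrite tofrac_eq0 monic_neq0 ?monicXn.
rewrite tofrac_eq => /eqP/(congr1 (fun p : {poly k} => size p)).
by rewrite !size_polyXn => -[].
Qed.

Lemma movable_Ginv (F : fieldType) (iota : {rmorphism k -> F})
    (Gamma : mx_class) (g : nat -> 'M[F]_2) w :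
  (forall n, g n \in unitmx) -> (forall n, Gamma F (g n)) ->
  (forall phi : nat -> {rmorphism ratfun4 k -> ratfun4 F},
     (forall n i, phi n (x i) =
        (rconst (g n 0 0) * rvar F i + rconst (g n 0 1)) /
        (rconst (g n 1 0) * rvar F i + rconst (g n 1 1))) ->
     injective (fun n => phi n w)) ->
  movable (Ginv Gamma) w.
Proof.
move=> gU gG phi_inj.
have [phi phiP] := choice (fun n => mobius_morph iota (gU n)).
have [psi [_ psix psic]] := free_rmorphism (base_change_free iota).
exists (ratfun4 F), phi; split; last first.
  by apply: phi_inj => n i; have [_ -> _] := phiP n.
have fixG n f : f \in Ginv Gamma -> phi n f = psi f.
  move=> /Ginv_morphP fG; have [_ phix phic] := phiP n.
  exact: (fG F iota (g n)).
by move=> n f fG; rewrite !fixG.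
Qed.

Definition mx22 (F : fieldType) (a b c d : F) : 'M[F]_2 :=
  \matrix_(i, j) if i == 0 then if j == 0 then a else b
                 else if j == 0 then c else d.

Lemma mx22E (F : fieldType) (a b c d : F) (g := mx22 a b c d) :
  [/\ g 0 0 = a, g 0 1 = b, g 1 0 = c & g 1 1 = d].
Proof. by rewrite !mxE. Qed.

Lemma movable_barycenter : movable (Ginv translation_mx) (barycenter x).
Proof.
have [F [iota [t [t_inj _]]]] := infinite_extension.
apply: (movable_Ginv iota (g := fun n => mx22 1 (t n) 0 1)).
- move=> n; have [a b c d] := mx22E 1 (t n) 0 1.
  by rewrite unitmx2P a b c d mulr0 mul1r subr0 oner_neq0.
- move=> n; have [a b c d] := mx22E 1 (t n) 0 1.
  by rewrite /translation_mx a c d !eqxx.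
move=> phi phix n m; rewrite !barycenter_morph.
have phixE n' i : (phi n' \o x) i = 1 * rvar F i + rconst (t n').
  have [a b c d] := mx22E 1 (t n') 0 1.
  by rewrite /= phix a b c d !rmorph1 rmorph0 mul0r add0r divr1.
rewrite !(barycenter_affine (oner_neq0 _) (phixE _) (total_weight_neq0 F)).
by move=> /addrI/fmorph_inj/t_inj.
Qed.

Lemma movable_spread : movable (Ginv affine_mx) (spread x).
Proof.
have [F [iota [t [t_inj t0]]]] := infinite_extension.
apply: (movable_Ginv iota (g := fun n => mx22 (t n) 0 0 1)).
- move=> n; have [a b c d] := mx22E (t n) 0 0 1.
  by rewrite unitmx2P a b c d mulr0 mulr1 subr0.
- move=> n; have [a b c d] := mx22E (t n) 0 0 1.
  by rewrite /affine_mx c !eqxx.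
move=> phi phix n m; rewrite !spread_morph.
have phixE n' i : (phi n' \o x) i = rconst (t n') * rvar F i + 0.
  have [a b c d] := mx22E (t n') 0 0 1.
  by rewrite /= phix a b c d !rmorph1 rmorph0 mul0r add0r divr1.
have r0 n' : rconst (t n') != 0 by rewrite fmorph_eq0.
rewrite !(spread_affine (r0 _) (phixE _) (total_weight_neq0 F)).
by move=> /(mulIf (spread_neq0 F))/fmorph_inj/t_inj.
Qed.

Lemma den_neq0 (F : fieldType) (c : F) i : rconst c * rvar F i + 1 != 0.
Proof.
by rewrite addrC -(rmorph1 (@rconst F)) linear_neq0 // oner_eq0.
Qed.

Fact ratio_inj (K : fieldType) (a b c c' : K) : a != b ->
  c * a + 1 != 0 -> c' * a + 1 != 0 ->
  (c * b + 1) / (c * a + 1) = (c' * b + 1) / (c' * a + 1) -> c = c'.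
Proof.
move=> ab h h' /eqP; rewrite eqr_div // -subr_eq0.
rewrite (_ : _ - _ = (c - c') * (b - a)); last by ring.
by rewrite mulf_eq0 !subr_eq0 (eq_sym b) (negPf ab) orbF => /eqP.
Qed.

(** The homographies x / (c x + 1) move the point at infinity. *)
Lemma movable_affine_ratio j l m : l != m -> l != j -> m != j ->
  movable (Ginv all_mx) (affine_ratio x j l m).
Proof.
move=> lm lj mj; have [F [iota [t [t_inj t0]]]] := infinite_extension.
apply: (movable_Ginv iota (g := fun n => mx22 1 0 (t n) 1)) => //.
  move=> n; have [a b c d] := mx22E 1 0 (t n) 1.
  by rewrite unitmx2P a b c d mul0r mulr1 subr0 oner_neq0.
move=> phi phix n n'; rewrite !affine_ratio_morph.
have phixE n0 i : (phi n0 \o x) i =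
    (1 * rvar F i + 0) / (rconst (t n0) * rvar F i + 1).
  have [a b c d] := mx22E 1 0 (t n0) 1.
  by rewrite /= phix a b c d !rmorph1 rmorph0.
have det0 (c : ratfun4 F) : 1 * 1 - 0 * c != 0.
  by rewrite mul0r mulr1 subr0 oner_neq0.
have lm0 := subx_neq0 (@rvar_inj F) lm.
rewrite !(affine_ratio_mobius (det0 _) (den_neq0 _) (phixE _)) //.
have aff0 : affine_ratio (rvar F) j l m != 0.
  by rewrite mulf_neq0 ?invr_eq0 ?(subx_neq0 (@rvar_inj F)).
move=> /(mulfI aff0) /ratio_inj e; apply/t_inj/(fmorph_inj (@rconst F)).
apply: e; [|exact: den_neq0|exact: den_neq0].
by rewrite (inj_eq (@rvar_inj F)) eq_sym.
Qed.

Fact shifted_ratio_inj (K : fieldType) (a b P M J c c' : K) :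
  a != 0 -> b != 0 -> M - J != 0 -> P + c - J != 0 -> P + c' - J != 0 ->
  (P + c - M) * a / ((P + c - J) * b) = (P + c' - M) * a / ((P + c' - J) * b) ->
  c = c'.
Proof.
move=> a0 b0 MJ h h' /eqP; rewrite eqr_div ?mulf_neq0 // -subr_eq0.
rewrite (_ : _ - _ = (c - c') * ((M - J) * a * b)); last by ring.
by rewrite mulf_eq0 subr_eq0 !(negPf (mulf_neq0 _ _)) ?mulf_neq0 // orbF => /eqP.
Qed.

Lemma movable_cross_ratio j l m p : quad j l m p ->
  movable (@kconst k) (cross_ratio x j l m p).
Proof.
move=> q; have [F [iota [t [t_inj _]]]] := infinite_extension.
have [phi phiP] := choice (fun n => shift_morph iota (t n) p).
exists (ratfun4 F), phi; split=> [n f /asboolP[c ->]|n n'].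
  by rewrite (phiP n).2 (phiP 0%N).2.
rewrite !cross_ratio_morph /cross_ratio /=.
have phip i : phi i (x p) = rvar F p + rconst (t i).
  by rewrite (phiP i).1 eqxx mulr1n.
have phix i a : a != p -> phi i (x a) = rvar F a.
  by rewrite (phiP i).1 => /negPf->; rewrite mulr0n rmorph0 addr0.
rewrite !phip !(phix _ m) ?(phix _ l) ?(phix _ j) ?(quadE q) //.
have den i : rvar F p + rconst (t i) - rvar F j != 0.
  rewrite -phip -(phix i j) ?(quadE q) // -rmorphB fmorph_eq0.
  by rewrite (subx_neq0 (@rvar_inj k)) // (quadE q).
move=> /shifted_ratio_inj e; apply/t_inj/(fmorph_inj (@rconst F)).
by apply: e => //; apply: (subx_neq0 (@rvar_inj F)); rewrite (quadE q).
Qed.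

Lemma affine_ratio_affine_in j l m : l != m -> affine_ratio x j l m \in Ginv affine_mx.
Proof.
move=> lm; apply/Ginv_morphP => F iota g phi psi gU /eqP g10 phix _ psix _.
rewrite !affine_ratio_morph; move: gU; rewrite unitmx2P g10 mulr0 subr0 mulf_eq0 negb_or.
case/andP=> g00 g11.
rewrite (affine_ratio_affine (x := psi \o x) (a := rconst (g 0 0 / g 1 1))
  (b := rconst (g 0 1 / g 1 1))) ?fmorph_eq0 ?mulf_neq0 ?invr_eq0 //.
by move=> i; rewrite /= phix psix g10 rmorph0 mul0r add0r mulrDl !fmorph_div
   mulrAC.
Qed.

Lemma spread_translation_in : spread x \in Ginv translation_mx.
Proof.
apply/Ginv_morphP => F iota g phi psi _ /and3P[/eqP g10 /eqP g00 /eqP g11].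
move=> phix _ psix _; rewrite !spread_morph.
rewrite (spread_affine (x := psi \o x) (a := 1) (b := rconst (g 0 1))).
- by rewrite mul1r.
- exact: oner_neq0.
- by move=> i; rewrite /= phix psix g10 g00 g11 rmorph0 !rmorph1 mul0r add0r divr1.
- rewrite (_ : psi \o x = rvar F) ?total_weight_neq0 //.
  by apply/funext => i /=; rewrite psix.
Qed.

Lemma cross_ratio_in j l m p : quad j l m p -> cross_ratio x j l m p \in Ginv all_mx.
Proof.
move=> q; apply/Ginv_morphP => F iota g phi psi gU _ phix _ psix _.
rewrite !cross_ratio_morph; move: (gU); rewrite unitmx2P => det0.
apply: (cross_ratio_mobius (x := psi \o x) (a := rconst (g 0 0)) (b := rconst (g 0 1))
   (c := rconst (g 1 0)) (d := rconst (g 1 1))).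
- by rewrite -!rmorphM -rmorphB fmorph_eq0.
- move=> i; rewrite /= psix addrC linear_neq0 //; apply: contra det0.
  by case/andP=> /eqP-> /eqP->; rewrite !mulr0 subr0.
- by move=> i; rewrite /= phix psix.
- by rewrite /= !psix (subx_neq0 (@rvar_inj F)) // (quadE q).
- by rewrite /= !psix (subx_neq0 (@rvar_inj F)) // (quadE q).
Qed.

Lemma Ginv_all_affine f : f \in @Ginv k all_mx -> f \in Ginv affine_mx.
Proof.
move=> /Ginv_morphP fG; apply/Ginv_morphP => F iota g phi psi gU _.
exact: fG.
Qed.

Lemma Ginv_affine_translation f :
  f \in @Ginv k affine_mx -> f \in Ginv translation_mx.
Proof.
move=> /Ginv_morphP fG; apply/Ginv_morphP => F iota g phi psi gU /andP[g10 _].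
exact: fG.
Qed.

(** E is generated over k by a cross-ratio, an affine ratio, the spread and the
barycenter.  From the top down, each of these generators is transcendental
over the invariants of a larger group, and [sandwich] identifies this
field of invariants with the field generated by the previous ones. *)
Lemma invariant_tower j l m p (A0 := adj (@kconst k) (cross_ratio x j l m p))
    (A1 := adj A0 (affine_ratio x j l m)) (A2 := adj A1 (spread x)) :
  quad j l m p ->
  [/\ {subset Ginv all_mx <= A0}, {subset Ginv affine_mx <= A1},
      {subset Ginv translation_mx <= A2} &
      forall f, f \in adj A2 (barycenter x)].
Proof.
move=> q.
have A0G : {subset A0 <= Ginv all_mx}.
  apply: adj_min (cross_ratio_in q) => f /asboolP[c ->]; exact: Ginv_const.
have A1G : {subset A1 <= Ginv affine_mx}.
  apply: adj_min => [f /A0G/Ginv_all_affine//|].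
  by apply: affine_ratio_affine_in; rewrite (quadE q).
have A2G : {subset A2 <= Ginv translation_mx}.
  apply: adj_min => [f /A1G/Ginv_affine_translation//|].
  exact: spread_translation_in.
have full f : f \in adj A2 (barycenter x).
  apply: ratfun_gen => [c|i].
    by do 3 apply: adj_sub; apply: adj_sub; apply: rconst_in.
  apply: (coords_in (@rvar_inj k) i q).
  - exact: adj_gen.
  - exact: total_weight_neq0.
  - exact: spread_neq0.
have G2 : {subset Ginv translation_mx <= A2}.
  apply: sandwich A2G _ (movable_transc movable_barycenter) => f _; exact: full.
have G1 : {subset Ginv affine_mx <= A1}.
  apply: sandwich A1G _ (movable_transc movable_spread) => f.
  by move=> /Ginv_affine_translation/G2.
have affT : movable (Ginv all_mx) (affine_ratio x j l m).
  by apply: movable_affine_ratio; rewrite (quadE q).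
split=> //; apply: sandwich A0G _ (movable_transc affT) => f.
by move/Ginv_all_affine; apply: G1.
Qed.

End Movable.

(** * The action of the symmetric group *)

Section SymmetricAction.
Variable k : fieldType.
Local Notation x := (rvar k).
Local Notation K4 := (@Ginv k all_mx).
Local Notation K5 := (@Ginv k affine_mx).
Local Notation K6 := (@Ginv k translation_mx).

Definition pact (s : 'S_4) : {rmorphism ratfun4 k -> ratfun4 k} := @perm_act k s.

Lemma pact_x s : pact s \o x = x \o s.
Proof. by apply/funext => i; apply: perm_act_var. Qed.

Lemma pact_barycenter s : pact s (barycenter x) = barycenter x.
Proof. by rewrite barycenter_morph pact_x barycenter_comp. Qed.

Lemma pact_spread s : pact s (spread x) = spread x.
Proof. by rewrite spread_morph pact_x spread_comp. Qed.

Lemma pact_pole s j : pact s (pole x j) = pole x (s j).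
Proof. by rewrite pole_morph pact_x pole_comp. Qed.

Lemma pact_cross_ratio s j l m p : pact s (cross_ratio x j l m p) =
  cross_ratio x (s j) (s l) (s m) (s p).
Proof. by rewrite cross_ratio_morph pact_x. Qed.

Lemma pact_affine_ratio s j l m : pact s (affine_ratio x j l m) =
  affine_ratio x (s j) (s l) (s m).
Proof. by rewrite affine_ratio_morph pact_x. Qed.

Lemma pact_Ginv Gamma s f : f \in Ginv Gamma -> pact s f \in Ginv Gamma.
Proof.
move=> /Ginv_morphP fG; apply/Ginv_morphP => F iota g phi psi gU gG.
move=> phix phic psix psic.
have phiE : phi (pact s f) = @perm_act F s (phi f).
  apply: (ratfun_morph_ext (f := phi \o pact s) (g := perm_act s \o phi)).
    by move=> c; rewrite /= perm_act_const phic perm_act_const.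
  move=> i; rewrite /= perm_act_var !phix fmorph_div !rmorphD !rmorphM.
  by rewrite /= !perm_act_const perm_act_var.
have psiE : psi (pact s f) = @perm_act F s (psi f).
  apply: (ratfun_morph_ext (f := psi \o pact s) (g := perm_act s \o psi)).
    by move=> c; rewrite /= perm_act_const psic perm_act_const.
  by move=> i; rewrite /= perm_act_var !psix perm_act_var.
by rewrite phiE psiE (fG F iota g phi psi).
Qed.

(** Membership in the normal Klein four-group. *)
Definition klein (n : 'S_4) :=
  (n == 1%g) || [forall i, (n i != i) && (n (n i) == i)].

(** A double transposition n exchanges j with n j and m with n m, and K4 is
generated by the cross-ratio of j, n j, m and n m, which this fixes. *)
Lemma klein_fix n : klein n -> {in K4, pact n =1 id}.
Proof.
case/orP=> [/eqP-> f _|/forallP nP f fK]; first exact: perm_act1.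
have [n0 nn0] : n 0 != 0 /\ n (n 0) = 0 by have /andP[? /eqP] := nP 0.
have /quad_exists[m [p q]] : (0 : 'I_4) != n 0 by rewrite eq_sym.
have nm : n m = p.
  have /andP[nm _] := nP m; have := quad_cover (n m) q.
  rewrite !inE (negPf nm) => /or4P[] // /eqP e; last by [].
    have : m = n 0 by apply: (@perm_inj _ n); rewrite nn0.
    by move/eqP/negPn; rewrite (quadE q).
  by have /eqP/negPn := perm_inj e; rewrite (quadE q).
have np : n p = m by rewrite -nm; have /andP[_ /eqP] := nP m.
have [K4A _ _ _] := invariant_tower k q.
apply: (adj_agree (f := pact n) (g := idfun) _ _ (K4A f fK)).
  by move=> _ /asboolP[c ->]; apply: perm_act_const.
rewrite /= pact_cross_ratio nn0 nm np /cross_ratio; congr (_ / _); ring.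
Qed.

Lemma affine_ratio_generates j l m p : quad j l m p ->
  {subset K5 <= adj K4 (affine_ratio x j l m)}.
Proof.
move=> q f fK; have [_ K5A _ _] := invariant_tower k q.
apply: adj_min (K5A f fK) => [g gA|]; last exact: adj_gen.
apply: adj_sub; apply: adj_min gA => [_ /asboolP[c ->]|]; first exact: Ginv_const.
exact: cross_ratio_in.
Qed.

Lemma spread_generates : {subset K6 <= adj K5 (spread x)}.
Proof.
have /quad_exists[m [p q]] : (0 : 'I_4) != 1 by [].
have [_ _ K6A _] := invariant_tower k q.
move=> f fK; apply: adj_min (K6A f fK) => [g gA|]; last exact: adj_gen.
apply: adj_sub; apply: adj_min gA => [h hA|]; last first.
  by apply: affine_ratio_affine_in; rewrite (quadE q).
apply: Ginv_all_affine; apply: adj_min hA => [_ /asboolP[c ->]|].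
  exact: Ginv_const.
exact: cross_ratio_in.
Qed.

Lemma barycenter_generates f : f \in adj K6 (barycenter x).
Proof.
have /quad_exists[m [p q]] : (0 : 'I_4) != 1 by [].
have [_ _ _ full] := invariant_tower k q.
apply: adj_min (full f) => [g gA|]; last exact: adj_gen.
apply: adj_sub; apply: adj_min gA => [h hA|]; last exact: spread_translation_in.
apply: Ginv_affine_translation; apply: adj_min hA => [i iA|]; last first.
  by apply: affine_ratio_affine_in; rewrite (quadE q).
apply: Ginv_all_affine; apply: adj_min iA => [_ /asboolP[c ->]|].
  exact: Ginv_const.
exact: cross_ratio_in.
Qed.

Section Subgroup.
Variable S : {group 'S_4}.

Definition no_mx : mx_class := fun F => pred0.

Lemma L4fixP f : L4fix k S f <-> f \in fixp (Ginv no_mx) pact S.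
Proof.
by split=> [fS|/fixpP[]//]; apply/fixpP; split=> //; apply/asboolP.
Qed.

Lemma K4fixP f : K4fix k S f <-> f \in fixp K4 pact S.
Proof.
split=> [[/PGL2_invariantE fK fS]|/fixpP[fK fS]]; first by apply/fixpP.
by split=> //; apply/PGL2_invariantE.
Qed.


Local Notation F A := (fixp A pact S).

(** The upper two steps of the tower descend to the invariants of S for
any S, since the spread and the barycenter are symmetric.  For the lower one,
y has degree |ns| over K4(X), which is the number of its conjugates under
elements of S acting trivially on K4; hence the elements of K5 fixed by S lie
in K4(X), and X is fixed by S. *)
Theorem rational_of_generator X y (G : {poly ratfun4 k}) (ns : seq 'S_4) :
  X \in K5 -> (forall s, s \in S -> pact s X = X) ->
  movable K4 y -> {subset K5 <= adj K4 y} ->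
  G \is a polyOver (adj K4 X) -> G \is monic -> G.[y] = 0 ->
  size G = (size ns).+1 -> {subset ns <= S} -> all klein ns ->
  uniq [seq pact n y | n <- ns] ->
  rational_over (L4fix k S) (K4fix k S).
Proof.
move=> XK SX y_mov Ky GK Gm Gy sG nsS kns uniq_y.
have fixS (A B : divringClosed (ratfun4 k)) : {subset A <= B} -> {subset F A <= F B}.
  by move=> AB f /fixpP[/AB fB fS]; apply/fixpP.
have fix_sub (A : divringClosed (ratfun4 k)) : {subset F A <= A} by move=> f /fixpP[].
have act1 f : pact 1%g f = f by apply: perm_act1.
have actM s t f : pact s (pact t f) = pact (t * s)%g f by apply: perm_actM.
have XT : transc K4 X.
  by apply: movable_alg y_mov GK _ Gy; rewrite monic_neq0.
have step1 : rational_over (fun f => f \in F K5) (fun f => f \in F K4).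
  apply: (@rational_step _ (fixp K4 pact S) (fixp K4 pact S)
            (fixp K5 pact S) X) => //.
  - exact: fixS (@Ginv_all_affine k).
  - move=> f /fixpP[fK fS]; apply: descent => //.
    + by move=> s g _; apply: pact_Ginv.
    + apply: (fixed_simple_ext (act := pact) GK Gm Gy sG _ uniq_y).
        move=> n nns; split; last exact/fS/nsS.
        apply: (adj_agree (f := pact n) (g := idfun)); last exact/SX/nsS.
        exact/klein_fix/(allP kns).
      apply: adj_min (Ky f fK) => [g gK|]; last exact: adj_gen.
      by do 2 apply: adj_sub.
  - exact/fixpP.
  - exact: transc_sub (fix_sub _) XT.
  - exact: rational_refl.
have step2 : rational_over (fun f => f \in F K6) (fun f => f \in F K4).
  apply: (@rational_step _ (fixp K4 pact S) (fixp K5 pact S)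
            (fixp K6 pact S) (spread x)) => //.
  - exact: fixS (@Ginv_all_affine k).
  - exact: fixS (@Ginv_affine_translation k).
  - move=> f /fixpP[fK fS]; apply: descent => //.
    + by move=> s g _; apply: pact_Ginv.
    + by move=> s _; apply: pact_spread.
    + exact/movable_transc/movable_spread.
    + exact: spread_generates.
  - apply/fixpP; split=> [|s _]; last exact: pact_spread.
    exact: spread_translation_in.
  - apply: transc_sub (fix_sub _) _; exact/movable_transc/movable_spread.
have inL f : f \in @Ginv k no_mx by apply/asboolP.
have [n [t [t_free tP]]] : rational_over (fun f => f \in F (Ginv no_mx))
    (fun f => f \in F K4).
  apply: (@rational_step _ (fixp K4 pact S) (fixp K6 pact S)
            (fixp (Ginv no_mx) pact S) (barycenter x)) => //.
  - by apply: fixS => f /Ginv_all_affine/Ginv_affine_translation.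
  - by apply: fixS => f _.
  - move=> f /fixpP[fK fS]; apply: descent => //.
    + by move=> s g _; apply: pact_Ginv.
    + by move=> s _; apply: pact_barycenter.
    + exact/movable_transc/movable_barycenter.
    + exact: barycenter_generates.
  - by apply/fixpP; split=> // s _; apply: pact_barycenter.
  - apply: transc_sub (fix_sub _) _; exact/movable_transc/movable_barycenter.
exists n, t; split=> [p pK|f].
  by apply: t_free => m; apply/K4fixP/pK.
have coefE (p : {mpoly (ratfun4 k)[n]}) :
    coefs_in (K4fix k S) p <-> coefs_in (fun f => f \in F K4) p.
  by split=> pK m; apply/K4fixP/pK.
split=> [/L4fixP/tP[p [q [pK qK q0 ->]]]|[p [q [pK qK q0 e]]]].
  by exists p, q; split=> //; apply/coefE.
by apply/L4fixP/tP; exists p, q; split=> //; apply/coefE.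
Qed.

End Subgroup.
End SymmetricAction.

(** * Orbits *)

Section OrbitGenerator.
Variable k : fieldType.
Local Notation x := (rvar k).
Local Notation K4 := (@Ginv k all_mx).
Local Notation K5 := (@Ginv k affine_mx).

(** The cross-ratio is transcendental over k, and each of these expressions is
the value at r of a nonzero polynomial. *)
Lemma cross_ratio_transc_cond j l m p (r := cross_ratio x j l m p) : quad j l m p ->
  [/\ r + 1 != 0, r - 2 != 0, 1 - 2 * r != 0 & r ^+ 2 - r + 1 != 0].
Proof.
move=> /(movable_cross_ratio k)/movable_transc; rewrite -/r; move: r => r rT.
have const (q : {poly ratfun4 k}) : q \is a polyOver (@kconst k) ->
    q`_0 = 1 -> q.[r] != 0.
  move=> qk q0; apply/eqP => /rT qr; have := oner_neq0 (ratfun4 k).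
  by rewrite -q0 qr ?coef0 ?eqxx.
have notin := transc_notin rT.
split.
- by rewrite addr_eq0 notin // rpredN rpred1.
- by rewrite subr_eq0 notin // rpred_nat.
- have -> : 1 - 2 * r = (1 - 2 *: 'X : {poly ratfun4 k}).[r].
    by rewrite !hornerE.
  apply: const; last by rewrite coefB coefZ coefX coef1 mulr0 subr0.
  by rewrite rpredB ?rpred1 ?polyOverZ ?rpred_nat ?polyOverX.
- have -> : r ^+ 2 - r + 1 = ('X^2 - 'X + 1 : {poly ratfun4 k}).[r].
    by rewrite !hornerE.
  apply: const; last by rewrite coefD coefB coefXn coefX coef1 subrr add0r.
  by rewrite rpredD ?rpredB ?rpred1 ?rpredX ?polyOverX.
Qed.

Lemma pole_affine j l m p : quad j l m p ->
  exists a b, [/\ a \in K4, b \in K4, a != 0 &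
    pole x j = a * affine_ratio x j l m + b].
Proof.
move=> q; have [r1 r2 r3 r4] := cross_ratio_transc_cond q.
exact: (pole_affine_ratio (@rvar_inj k) q (cross_ratio_in k q) r1 r2 r3 r4).
Qed.

Lemma exists_quad (j : 'I_4) : exists l m p, quad j l m p.
Proof.
suff [l jl] : exists l : 'I_4, j != l.
  by have [m [p q]] := quad_exists jl; exists l, m, p.
exists (if j == 0 then 1 else 0); by case: (eqVneq j 0) => [->|].
Qed.

Lemma pole_movable j : movable K4 (pole x j).
Proof.
have [l [m [p q]]] := exists_quad j.
have [a [b [aK bK a0 ->]]] := pole_affine q.
by apply: movable_affine => //; apply: movable_affine_ratio; rewrite (quadE q).
Qed.

Lemma pole_generates j : {subset K5 <= adj K4 (pole x j)}.
Proof.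
have [l [m [p q]]] := exists_quad j.
have [a [b [aK bK a0 e]]] := pole_affine q.
move=> f fK; apply: adj_min (affine_ratio_generates q fK) => [g gK|].
  exact: adj_sub.
have -> : affine_ratio x j l m = (pole x j - b) / a.
  by rewrite e addrK mulrC mulKf.
apply: rpred_div; last exact: adj_sub.
by apply: rpredB; [exact: adj_gen|exact: adj_sub].
Qed.

Lemma pole_affine_in j : pole x j \in K5.
Proof.
have [l [m [p q]]] := exists_quad j.
have [a [b [aK bK a0 ->]]] := pole_affine q.
apply: rpredD; last exact: Ginv_all_affine.
apply: rpredM; first exact: Ginv_all_affine.
by apply: affine_ratio_affine_in; rewrite (quadE q).
Qed.

(** The affine ratios of which x_i and x_j are the poles are inverse to each
other, and [pole] is an affine function of them. *)
Lemma pole_fraction i j : i != j -> exists r b c,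
  [/\ r \in K4, b \in K4, c \in K4, pole x i != r &
      pole x j = b + c / (pole x i - r)].
Proof.
move=> ij; have [l [p q]] := quad_exists ij.
have qi : quad i l j p by rewrite /quad /= !inE !negb_or !(quadE q).
have qj : quad j l i p by rewrite /quad /= !inE !negb_or !(quadE q).
have [a [b [aK bK a0 ei]]] := pole_affine qi.
have [c [d [cK dK c0 ej]]] := pole_affine qj.
exists b, d, (c * a).
have caK : c * a \in K4 := rpredM cK aK.
have ne : pole x i != b := transc_notin (movable_transc (pole_movable i)) bK.
split=> //; rewrite ej addrC; congr (_ + _).
have e1 : affine_ratio x i l j * affine_ratio x j l i = 1.
  by apply: (affine_ratio_swap (@rvar_inj k)); rewrite (quadE q).
have : affine_ratio x i l j != 0.
  by apply: contra_eq_neq e1 => ->; rewrite mul0r eq_sym oner_neq0.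
rewrite ei addrK; move: (affine_ratio x i l j) (affine_ratio x j l i) e1 => y z yz y0.
have -> : z = y^-1 by apply: (mulfI y0); rewrite yz divff.
by rewrite invfM mulrA mulfK.
Qed.

Lemma pole_neq i j : i != j -> pole x i != pole x j.
Proof.
move=> ij; have [r [b [c [rK bK cK ne e]]]] := pole_fraction ij.
rewrite e; exact: transc_neq_fraction (movable_transc (pole_movable i)) _ _ _ _.
Qed.

(** The sum X of the [pole x j] over the orbit O of i is fixed by S, and a
function of degree |O| of y = [pole x i], the poles being distinct.  The
hypothesis provides, for each j in O, an element of S that acts trivially on
K4 and maps y to [pole x j]: this makes |O| conjugates of y. *)
Theorem rational_of_orbit (S : {group 'S_4}) i :
  (forall s, s \in S -> exists n, [/\ n \in S, klein n & n i = s i]) ->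
  rational_over (L4fix k S) (K4fix k S).
Proof.
move=> kleinS; pose O := [set s i | s : 'S_4 in S].
have iO : i \in O by apply/imsetP; exists 1%g; rewrite ?group1 ?perm1.
have /choice[N NP] : forall j : 'I_4, exists n : 'S_4,
    j \in O -> [/\ n \in S, klein n & n i = j].
  move=> j; have [/imsetP[s sS ->]|] := boolP (j \in O); last by exists 1%g.
  by have [n nP] := kleinS s sS; exists n.
have /choice[f fP] : forall j : 'I_4, exists rbc : ratfun4 k * ratfun4 k * ratfun4 k,
    i != j -> [/\ rbc.1.1 \in K4, rbc.1.2 \in K4, rbc.2 \in K4,
      pole x i != rbc.1.1 & pole x j = rbc.1.2 + rbc.2 / (pole x i - rbc.1.1)].
  move=> j; have [_|/pole_fraction[r [b [c rbcP]]]] := eqVneq i j.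
    by exists (0, 0, 0).
  by exists (r, b, c).
pose o := enum (O :\ i).
have oP j : j \in o -> i != j by rewrite mem_enum !inE eq_sym => /andP[].
pose X := \sum_(j in O) pole x j.
have XE : X = pole x i + \sum_(j <- o) pole x j.
  by rewrite /X (big_setD1 i) //= -big_enum.
have [|||||G [GK Gm sG Gy]] := @partial_fraction_poly _ (adj K4 X) _ o
    (fun j => (f j).1.1) (fun j => (f j).2)
    (X - \sum_(j <- o) (f j).1.2) (pole x i).
- exact: enum_uniq.
- by move=> j /oP/fP[? ? ? _ _]; split; apply: adj_sub.
- apply: rpredB; first exact: adj_gen.
  by rewrite big_seq; apply: rpred_sum => j /oP/fP[_ bK _ _ _]; apply: adj_sub.
- by move=> j /oP/fP[].
- have -> : X = pole x i + (\sum_(j <- o) (f j).2 / (pole x i - (f j).1.1) +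
      \sum_(j <- o) (f j).1.2).
    rewrite XE addrC [in RHS]addrC -big_split /=; congr (_ + _).
    by apply: eq_big_seq => j /oP/fP[_ _ _ _ ->]; rewrite addrC.
  by rewrite addrA addrK opprD addrA subrr add0r addNr.
apply: (@rational_of_generator _ _ X (pole x i) G [seq N j | j <- enum O]).
- by apply: rpred_sum => j _; apply: pole_affine_in.
- move=> s sS; rewrite rmorph_sum /X.
  rewrite [RHS](reindex_inj (@perm_inj _ s)) /=.
  apply: eq_big => [j|j _]; last exact: pact_pole.
  apply/idP/idP => [/imsetP[t tS ->]|/imsetP[t tS e]]; apply/imsetP.
    by exists (t * s)%g; rewrite ?groupM ?permM.
  by exists (t * s^-1)%g; rewrite ?groupM ?groupV // permM -e permK.
- exact: pole_movable.
- exact: pole_generates.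
- exact: GK.
- exact: Gm.
- exact: Gy.
- by rewrite sG size_map -!cardE (cardsD1 i O) iO.
- by move=> _ /mapP[j + ->]; rewrite mem_enum => /NP[].
- by apply/allP => _ /mapP[j + ->]; rewrite mem_enum => /NP[].
- rewrite -map_comp map_inj_in_uniq ?enum_uniq // => j l.
  rewrite !mem_enum => /NP[_ _ nj] /NP[_ _ nl] /=.
  rewrite !pact_pole nj nl; apply: contra_eq => jl; exact: pole_neq.
Qed.

End OrbitGenerator.

(** * Subgroups of the symmetric group of degree four *)

Section SubgroupSearch.
Local Open Scope nat_scope.

(** Permutations as lists of numbers, with which the kernel can compute. *)
Definition code (s : 'S_4) : seq nat := [seq val (s i) | i <- enum 'I_4].

Lemma nth_code s (i : 'I_4) : nth 0 (code s) i = s i.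
Proof. by rewrite (nth_map i) ?size_enum_ord // nth_ord_enum. Qed.

Lemma code_inj : injective code.
Proof.
by move=> s t e; apply/permP => i; apply/val_inj; rewrite /= -!nth_code e.
Qed.

Definition codeM (p q : seq nat) := [seq nth 0 q i | i <- p].

Lemma code_mul s t : code (s * t)%g = codeM (code s) (code t).
Proof.
rewrite /codeM /code -map_comp; apply: eq_map => i /=.
by rewrite -/(code t) nth_code permM.
Qed.

Lemma code_one : code 1%g = iota 0 4.
Proof.
by rewrite -val_enum_ord; apply: eq_map => i; rewrite perm1.
Qed.

Lemma code_permutations s : code s \in permutations (iota 0 4).
Proof.
rewrite mem_permutations -val_enum_ord /code (map_comp val s).
apply: perm_map; apply: uniq_perm; rewrite ?enum_uniq //.
  by rewrite map_inj_uniq ?enum_uniq //; apply: perm_inj.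
move=> i; rewrite mem_enum; apply/mapP; exists (s^-1 i)%g.
  by rewrite mem_enum.
by rewrite permKV.
Qed.

Definition klein_code (p : seq nat) :=
  (p == iota 0 4) ||
  all (fun i => (nth 0 p i != i) && (nth 0 p (nth 0 p i) == i)) (iota 0 4).

Lemma klein_codeP n : klein_code (code n) -> klein n.
Proof.
case/orP=> [|/allP nP]; first by rewrite -code_one (inj_eq code_inj) /klein => ->.
apply/orP; right; apply/forallP => i.
have /nP : val i \in iota 0 4 by rewrite mem_iota ltn_ord.
by rewrite !nth_code.
Qed.

Definition klein_orbit (yes : seq (seq nat)) :=
  has (fun i => all (fun p => has (fun q =>
    klein_code q && (nth 0 q i == nth 0 p i)) yes) yes) (iota 0 4).

Definition cyclic4 (yes : seq (seq nat)) :=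
  (size (undup yes) == 4) && has (fun p => codeM p p != iota 0 4) yes.

(** [mem_code] decides membership without going through the generic equality,
which is slow to evaluate. *)
Fixpoint eq_code (p q : seq nat) : bool :=
  match p, q with
  | [::], [::] => true
  | a :: p', b :: q' => if eqn a b then eq_code p' q' else false
  | _, _ => false
  end.

Definition mem_code (p : seq nat) := has (eq_code p).

Lemma mem_codeE p l : mem_code p l = (p \in l).
Proof.
rewrite -has_pred1; apply: eq_has => q /=; rewrite eq_sym.
elim: p q => [|a p IH] [|b q] //=; rewrite IH eqseq_cons eqnE.
by case: (a == b).
Qed.

(** Enumeration of all subgroups.  The lists [yes] and [no] hold elements known
to be inside and outside; a product of elements of [yes] must be inside, and
when there is no new product an undecided element is tried both ways.  The
conditionals keep the evaluation lazy, so that contradictory branches stop. *)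
Fixpoint search (all_codes : seq (seq nat)) (fuel : nat)
    (yes no : seq (seq nat)) : bool :=
  if fuel isn't n.+1 then false else
  if [seq r <- [seq codeM p q | p <- yes, q <- yes] | ~~ mem_code r yes]
    is r :: _ then
    if mem_code r no then true else search all_codes n (r :: yes) no
  else if [seq r <- all_codes | if mem_code r yes then false else ~~ mem_code r no]
    is r :: _ then
    if search all_codes n (r :: yes) no then search all_codes n yes (r :: no)
    else false
  else if klein_orbit yes then true else cyclic4 yes.

(** Each step decides about one of the 24 permutations, which bounds the fuel. *)
Lemma search_true : search (permutations (iota 0 4)) 30 [:: iota 0 4] [::].
Proof. by vm_compute. Qed.

Section SearchSound.
Variable S : {group 'S_4}.

Lemma klein_orbitP (yes : seq (seq nat)) :
  (forall p, p \in yes -> exists2 s, s \in S & p = code s) ->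
  (forall s, s \in S -> code s \in yes) -> klein_orbit yes ->
  exists i, forall s, s \in S -> exists n, [/\ n \in S, klein n & n i = s i].
Proof.
move=> yesS Syes /hasP[i]; rewrite mem_iota /= => i4 /allP iP.
exists (Ordinal i4) => s /Syes/iP/hasP[q /yesS[n nS ->]] /andP[kn].
rewrite -[i]/(val (Ordinal i4)) !nth_code => /eqP e; exists n.
by split=> //; [exact: klein_codeP|exact: val_inj].
Qed.

Lemma cyclic4P (yes : seq (seq nat)) :
  (forall p, p \in yes -> exists2 s, s \in S & p = code s) ->
  (forall s, s \in S -> code s \in yes) -> cyclic4 yes ->
  cyclic S /\ #|S| = 4%N.
Proof.
move=> yesS Syes /andP[/eqP size_yes /hasP[p /yesS[s sS ->]]].
rewrite -code_mul -code_one (inj_eq code_inj) => s2.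
have S4 : #|S| = 4%N.
  rewrite cardE -(size_map code) -[RHS]size_yes; apply/perm_size/uniq_perm.
  - by rewrite map_inj_uniq ?enum_uniq //; apply: code_inj.
  - exact: undup_uniq.
  - move=> q; rewrite mem_undup; apply/mapP/idP => [[t + ->]|/yesS[t tS ->]].
      by rewrite mem_enum => /Syes.
    by exists t; rewrite ?mem_enum.
split=> //; apply/cyclicP; exists s; apply/esym/eqP.
rewrite eqEcard cycle_subG sS S4 /=.
have : #[s]%g %| 4 by have := order_dvdG sS; rewrite S4.
have : ~~ (#[s]%g %| 2) by rewrite order_dvdn expgS expg1.
rewrite orderE; move: #|_|; case=> [|[|[|[|[|n]]]]] //.
Qed.

Lemma search_sound all_codes fuel yes no :
  (forall s, code s \in all_codes) ->
  (forall p, p \in yes -> exists2 s, s \in S & p = code s) ->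
  (forall s, s \in S -> code s \notin no) ->
  search all_codes fuel yes no ->
  (exists i, forall s, s \in S -> exists n, [/\ n \in S, klein n & n i = s i])
  \/ (cyclic S /\ #|S| = 4%N).
Proof.
move=> allP; elim: fuel yes no => [//|fuel IH] yes no yesS noS /=.
case Em: [seq _ <- _ | _] => [|r m].
  case Eu: [seq _ <- _ | _] => [|r u].
    have Syes s : s \in S -> code s \in yes.
      move=> sS; apply: contraT => syes.
      suff : code s \in [::] by [].
      rewrite -Eu mem_filter allP !mem_codeE (negPf syes).
      by rewrite noS.
    case: ifP => [kS _|_ cS]; [left|right]; first exact: klein_orbitP kS.
    exact: cyclic4P cS.
  case: ifP => // sy sn.
  have [[s sS e]|nS] := pselect (exists2 s, s \in S & code s = r).
    apply: IH sy => // p; rewrite inE => /predU1P[->|/yesS//].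
    by exists s.
  apply: IH sn => // s sS; rewrite inE negb_or noS // andbT.
  by apply/eqP => e; apply: nS; exists s.
have : r \in r :: m by rewrite mem_head.
rewrite -Em mem_filter => /andP[_ /allpairsP[[p q] /= [/yesS[s sS ->] /yesS[t tS ->]]]].
rewrite -code_mul => ->; rewrite mem_codeE (negPf (noS _ (groupM sS tS))).
apply: IH => // p'; rewrite inE => /predU1P[->|/yesS//].
by exists (s * t)%g; rewrite ?groupM.
Qed.

(** The orbit condition of [rational_of_orbit] fails only for the cyclic groups
of order four. *)
Lemma klein_orbit_or_cyclic4 :
  ~ (cyclic S /\ #|S| = 4%N) ->
  exists i, forall s, s \in S -> exists n, [/\ n \in S, klein n & n i = s i].
Proof.
have idS p : p \in [:: iota 0 4] -> exists2 s, s \in S & p = code s.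
  by rewrite inE => /eqP->; exists 1%g; rewrite ?group1 // code_one.
by case: (search_sound code_permutations idS _ search_true).
Qed.
End SearchSound.
End SubgroupSearch.

(** * The cyclic group of order four *)

Fact half_ratio_root (K : fieldType) (x0 x1 x2 x3 : K)
    (y := (x0 - x1) / (x0 - x2)) (r := (x0 - x2) / (x1 - x3))
    (mu := (x3 - x2) * (x0 - x1) / ((x3 - x1) * (x0 - x2))) :
  x0 - x2 != 0 -> x1 - x3 != 0 -> r * (y ^+ 2 - y) + y - mu = 0.
Proof.
move=> h02 h13; rewrite /y /r /mu -[x3 - x1]opprB; field.
by rewrite h02 h13 oppr_eq0 h13.
Qed.

Fact divide_half_root (K : fieldType) (y r mu : K) :
  r != 0 -> r * (y ^+ 2 - y) + y - mu = 0 ->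
  (y - (1 - r^-1)) * y - mu / r = 0.
Proof.
move=> r0 e; have -> : (y - (1 - r^-1)) * y - mu / r =
    (r * (y ^+ 2 - y) + y - mu) / r by field.
by rewrite e mul0r.
Qed.

Fact cross_ratio_turn (K : fieldType) (x0 x1 x2 x3 : K) :
  x0 - x2 != 0 -> x1 - x3 != 0 ->
  (x0 - x3) * (x1 - x2) / ((x0 - x2) * (x1 - x3)) =
  1 - (x3 - x2) * (x0 - x1) / ((x3 - x1) * (x0 - x2)).
Proof.
move=> h02 h13; rewrite -[x3 - x1]opprB; field.
by rewrite h02 h13 oppr_eq0 h13.
Qed.

Fact opposite_ratio_root (K : fieldType) (x0 x1 x2 x3 : K)
    (y := (x0 - x1) / (x0 - x2))
    (mu := (x3 - x2) * (x0 - x1) / ((x3 - x1) * (x0 - x2))) :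
  x0 - x2 != 0 -> x3 - x1 != 0 -> y = (x2 - x3) / (x2 - x0) ->
  y ^+ 2 - 2 * mu * y + mu = 0.
Proof.
move=> h02 h31; rewrite /y -[x2 - x0]opprB invrN mulrN -mulNr.
move/(mulIf (invr_neq0 h02)) => e.
have e3 : x3 = x0 - x1 + x2 by rewrite e; ring.
rewrite /mu e3 in h31 *; field.
by rewrite h02 h31.
Qed.

(** A generator s and a point i that its square moves: s permutes the points
i, s i, s^2 i and s^3 i cyclically. *)
Lemma cyclic4_turn (S : {group 'S_4}) : cyclic S -> #|S| = 4%N ->
  exists (s : 'S_4) (i : 'I_4), [/\ S :=: <[s]>%g, s (s (s (s i))) = i,
    klein (s * s)%g & quad (s i) i (s (s i)) (s (s (s i)))].
Proof.
move=> /cyclicP[s Ss] S4; exists s.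
have ords : #[s]%g = 4%N by rewrite orderE -Ss.
have s4 j : s (s (s (s j))) = j.
  have : (s ^+ 4)%g = 1%g by have := expg_order s; rewrite ords.
  by rewrite !expgS expg0 mulg1 => /permP/(_ j); rewrite !permM perm1.
have [i i2] : exists i, s (s i) != i.
  apply: contrapT => no_i; have : (#[s]%g %| 2)%N; last by rewrite ords.
  rewrite order_dvdn expgS expg1; apply/eqP/permP => j; rewrite permM perm1.
  by apply: contrapT => /eqP sj; apply: no_i; exists j.
have i1 : s i != i by apply: contraNneq i2 => e; rewrite !e.
have i3 : s (s (s i)) != i.
  by apply: contraNneq i1 => e; rewrite -[in X in _ == X](s4 i) e.
have q : quad (s i) i (s (s i)) (s (s (s i))).
  rewrite /quad /= !inE !negb_or !(inj_eq (@perm_inj _ s)).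
  by rewrite i1 ![i == _]eq_sym i2 i3 i1.
exists i; split=> //; apply/orP; right; apply/forallP => j.
rewrite !permM s4 eqxx andbT; have := quad_cover j q.
rewrite !inE => /or4P[] /eqP->; rewrite ?s4 ?(inj_eq (@perm_inj _ s)) // eq_sym //.
Qed.

Section CyclicOfOrderFour.
Variables (k : fieldType) (S : {group 'S_4}) (s : 'S_4) (i0 : 'I_4).
Local Notation x := (rvar k).
Local Notation K4 := (@Ginv k all_mx).
Local Notation K5 := (@Ginv k affine_mx).
Local Notation i1 := (s i0).
Local Notation i2 := (s i1).
Local Notation i3 := (s i2).
Hypotheses (Ss : S :=: <[s]>%g) (s4 : s i3 = i0) (kss : klein (s * s)%g).
Hypothesis q : quad i1 i0 i2 i3.

Lemma pact_cycle f : pact k s f = f -> forall t, t \in S -> pact k t f = f.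
Proof.
move=> sf t; rewrite Ss => /cycleP[n ->]; elim: n => [|n IH].
  by rewrite expg0; apply: perm_act1.
by rewrite expgS -[pact _ _ f](@perm_actM k) [X in perm_act _ X]sf.
Qed.

(** The cross-ratio that s maps to 1 - mu. *)
Definition mu := cross_ratio x i1 i0 i2 i3.
(** A generator over K4 of the invariants of the square of s in K5. *)
Definition half_ratio := (x i0 - x i2) / (x i1 - x i3).
Local Notation y := (affine_ratio x i1 i0 i2).
Local Notation r0 := half_ratio.

Let d02 : x i0 - x i2 != 0.
Proof. by apply: (subx_neq0 (@rvar_inj k)); rewrite (quadE q). Qed.
Let d13 : x i1 - x i3 != 0.
Proof. by apply: (subx_neq0 (@rvar_inj k)); rewrite (quadE q). Qed.

Lemma mu_in : mu \in K4. Proof. exact: cross_ratio_in. Qed.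

Lemma half_ratio_neq0 : r0 != 0.
Proof. exact: mulf_neq0 d02 (invr_neq0 d13). Qed.

Lemma half_ratio_eq : r0 * (y ^+ 2 - y) + y - mu = 0.
Proof.
by rewrite /affine_ratio /half_ratio /mu /cross_ratio (half_ratio_root d02 d13).
Qed.

Lemma pact_mu : pact k s mu = 1 - mu.
Proof.
rewrite pact_cross_ratio s4 /mu /cross_ratio; exact: (cross_ratio_turn d02 d13).
Qed.

Lemma pact_half_ratio : pact k s r0 = - r0^-1.
Proof.
rewrite /half_ratio fmorph_div !rmorphB /= !perm_act_var s4 invf_div -mulrN.
by rewrite -invrN opprB.
Qed.

(** The equation of the affine ratio y over K4(r), obtained by writing r in
terms of y and of mu. *)
Definition half_poly : {poly ratfun4 k} :=
  ('X - (1 - r0^-1)%:P) * 'X - (mu / r0)%:P.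

Lemma half_poly_monic : half_poly \is monic /\ size half_poly = 3%N.
Proof.
have sX : size (('X - (1 - r0^-1)%:P) * 'X) = 3%N.
  by rewrite size_monicM ?monicXsubC ?polyX_eq0 // size_XsubC size_polyX.
have sC : (size (- (mu / r0)%:P) < size (('X - (1 - r0^-1)%:P) * 'X)%R)%N.
  by rewrite sX size_polyN ltnS (leq_trans (size_polyC_leq1 _)).
rewrite /half_poly monicE lead_coefDl // -monicE monicMr ?monicXsubC ?monicX //.
by rewrite size_polyDl.
Qed.

Lemma half_poly_root : half_poly.[y] = 0.
Proof.
rewrite /half_poly hornerD hornerN hornerM hornerXsubC hornerX hornerC.
exact: divide_half_root half_ratio_neq0 half_ratio_eq.
Qed.

Lemma half_poly_over (A : divringClosed (ratfun4 k)) :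
  mu \in A -> r0 \in A -> half_poly \is a polyOver A.
Proof.
move=> mA rA; apply: rpredB; last by rewrite polyOverC rpred_div.
apply: rpredM; last exact: polyOverX.
by rewrite polyOverXsubC rpredB ?rpred1 // rpredV.
Qed.

Lemma movable_y : movable K4 y.
Proof. by apply: movable_affine_ratio; rewrite (quadE q). Qed.

Lemma half_ratio_transc : transc K4 r0.
Proof.
apply: movable_alg movable_y _ _ half_poly_root.
  by apply: half_poly_over; [apply/adj_sub/mu_in|exact: adj_gen].
exact: (monic_neq0 half_poly_monic.1).
Qed.

Lemma half_ratio_in : r0 \in K5.
Proof.
have yK : y \in K5 by apply: affine_ratio_affine_in; rewrite (quadE q).
have y0 : y ^+ 2 - y != 0.
  have yT := movable_transc movable_y.
  have -> : y ^+ 2 - y = (y - 0) * (y - 1) by rewrite subr0 mulrBr mulr1.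
  by apply: mulf_neq0; rewrite subr_eq0 (transc_notin yT) ?rpred0 ?rpred1.
have -> : r0 = (mu - y) / (y ^+ 2 - y).
  apply: (mulIf y0); rewrite divfK //; apply/eqP; rewrite -subr_eq0 opprB addrA.
  by rewrite half_ratio_eq.
apply: rpred_div; apply: rpredB => //; last exact: rpredX.
exact/Ginv_all_affine/mu_in.
Qed.

(** If the square of s fixed y, then y would be algebraic over K4, with
equation y^2 - 2 mu y + mu = 0. *)
Lemma pact_half_y : pact k (s * s)%g y != y.
Proof.
rewrite pact_affine_ratio !permM s4; apply/eqP => e.
have d31 : x i3 - x i1 != 0 by rewrite -opprB oppr_eq0.
have := opposite_ratio_root d02 d31 (esym e); rewrite -/mu -/y => yr.
have : ('X - (2 * mu)%:P) * 'X + mu%:P = 0 :> {poly ratfun4 k}.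
  apply: (movable_transc movable_y).
    have mK := mu_in.
    apply: rpredD; last by rewrite polyOverC.
    apply: rpredM; last exact: polyOverX.
    by rewrite polyOverXsubC rpredM ?rpred_nat.
  by rewrite hornerD hornerM hornerXsubC hornerX hornerC mulrBl -expr2.
move/eqP; rewrite -size_poly_eq0 size_MXaddC polyXsubC_eq0 /=.
by rewrite size_XsubC.
Qed.

(** Any X in K5 fixed by s and such that K4(X) contains r generates the
invariants: y has degree two over K4(X) and two conjugates under the square
of s. *)
Theorem rational_of_turn X : X \in K5 -> pact k s X = X -> r0 \in adj K4 X ->
  rational_over (L4fix k S) (K4fix k S).
Proof.
move=> XK sX rX; have [Gm sG] := half_poly_monic.
apply: (@rational_of_generator _ _ X y half_poly [:: 1%g; (s * s)%g]).
- exact: XK.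
- exact: pact_cycle.
- exact: movable_y.
- exact: affine_ratio_generates q.
- apply: half_poly_over => //; exact/adj_sub/mu_in.
- exact: Gm.
- exact: half_poly_root.
- by rewrite sG.
- by move=> t; rewrite !inE => /pred2P[] ->; rewrite ?group1 // Ss groupM ?cycle_id.
- by rewrite /= kss /klein eqxx.
- rewrite /= inE andbT eq_sym [pact k 1%g _](@perm_act1 k).
  exact: pact_half_y.
Qed.

End CyclicOfOrderFour.

(** * Sums of two squares *)

Fact clear_denominators (K : fieldType) (sigma p1 q1 p2 q2 p3 q3 : K) :
  q1 != 0 -> q2 != 0 -> q3 != 0 ->
  (p1 / q1) ^+ 2 + (p2 / q2) ^+ 2 = sigma * (p3 / q3) ^+ 2 ->
  (p1 * q2 * q3) ^+ 2 + (p2 * q1 * q3) ^+ 2 = sigma * (p3 * q1 * q2) ^+ 2.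
Proof.
move=> q10 q20 q30 e; apply/eqP; rewrite -subr_eq0; apply/eqP.
transitivity ((q1 * q2 * q3) ^+ 2 *
  ((p1 / q1) ^+ 2 + (p2 / q2) ^+ 2 - sigma * (p3 / q3) ^+ 2)).
  by field; rewrite q10 q20 q30.
by rewrite e subrr mulr0.
Qed.

Lemma coef_square (E : fieldType) (p : {poly E}) n : (size p <= n.+1)%N ->
  (p ^+ 2)`_(n + n) = p`_n ^+ 2.
Proof.
move=> sp; have lt_n : (n < (n + n).+1)%N by rewrite ltnS leq_addr.
rewrite expr2 coefM (bigD1 (Ordinal lt_n)) //= addnK big1 ?addr0 // => j.
rewrite -val_eqE /= neq_ltn => /orP[ltj|ltj].
  rewrite [X in _ * X]nth_default ?mulr0 // (leq_trans sp) //.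
  by rewrite -addnBA ?(ltnW ltj) // -addn1 leq_add2l subn_gt0.
by rewrite nth_default ?mul0r // (leq_trans sp).
Qed.

(** After clearing denominators, the coefficients of highest even degree in
P^2 + Q^2 = 'X R^2 have to cancel on the left, as the right-hand side has odd
degree. *)
Lemma two_squares_transc (E : fieldType) (A : divringClosed E) (sigma a b c : E) :
  transc A sigma ->
  a \in adj A sigma -> b \in adj A sigma -> c \in adj A sigma ->
  [|| a != 0, b != 0 | c != 0] -> a ^+ 2 + b ^+ 2 = sigma * c ^+ 2 ->
  exists2 e, e \in A & e ^+ 2 = -1.
Proof.
move=> sT /adjP[p1 [q1 [p1A q1A q10 aE]]] /adjP[p2 [q2 [p2A q2A q20 bE]]].
move=> /adjP[p3 [q3 [p3A q3A q30 cE]]] nz e.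
pose P := p1 * q2 * q3; pose Q := p2 * q1 * q3; pose R := p3 * q1 * q2.
have PA : P \is a polyOver A by rewrite !rpredM.
have QA : Q \is a polyOver A by rewrite !rpredM.
have PQR : P ^+ 2 + Q ^+ 2 = 'X * R ^+ 2.
  apply/eqP; rewrite -subr_eq0; apply/eqP/sT.
    have RA : R \is a polyOver A by rewrite !rpredM.
    by rewrite rpredB ?rpredD ?rpredM ?rpredX ?polyOverX.
  rewrite !(hornerD, hornerN, horner_exp, hornerM, hornerX).
  by rewrite (clear_denominators (sigma := sigma) (p3 := p3.[sigma]) q10 q20 q30)
    ?subrr // -aE -bE -cE.
have nzPQR : [|| P != 0, Q != 0 | R != 0].
  have q0 (q : {poly E}) : q.[sigma] != 0 -> q != 0.
    by apply: contraNneq => ->; rewrite horner0.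
  have num0 (f : E) (p q : {poly E}) : f = p.[sigma] / q.[sigma] -> f != 0 -> p != 0.
    by move=> ->; apply: contraNneq => ->; rewrite horner0 mul0r.
  rewrite !mulf_eq0 !negb_or !(q0 q1) // !(q0 q2) // !(q0 q3) // !andbT.
  by case/or3P: nz => [/(num0 _ _ _ aE)|/(num0 _ _ _ bE)|/(num0 _ _ _ cE)] ->;
    rewrite ?orbT.
have [n [sP sQ nzn]] : exists n, [/\ (size P <= n.+1)%N, (size Q <= n.+1)%N &
    (P`_n != 0) || (Q`_n != 0)].
  have sPQ0 : (0 < maxn (size P) (size Q))%N.
    rewrite leq_max !size_poly_gt0; apply: contraTT nzPQR.
    rewrite negb_or !negbK => /andP[P0 Q0]; rewrite (eqP P0) (eqP Q0) eqxx /=.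
    move/esym/eqP: PQR; rewrite (eqP P0) (eqP Q0) expr0n addr0.
    by rewrite mulf_eq0 polyX_eq0 expf_eq0 /= => ->.
  exists (maxn (size P) (size Q)).-1.
  rewrite prednK // leq_maxl leq_maxr; split=> //.
  case: (leqP (size P) (size Q)) sPQ0 => _ s0; apply/orP; [right|left];
    by rewrite -lead_coefE lead_coef_eq0 -size_poly_gt0.
have PQn : P`_n ^+ 2 + Q`_n ^+ 2 = 0.
  rewrite -!coef_square // -coefD PQR nth_default //.
  have [->|R0] := eqVneq R 0; first by rewrite expr0n mulr0 size_poly0.
  have sR : size ('X * R ^+ 2) = (size R).*2.
    rewrite mulrC size_mulX ?expf_neq0 // expr2 size_mul //.
    by rewrite addnn prednK // double_gt0 size_poly_gt0.
  have : (size ('X * R ^+ 2)%R <= (n + n).+1)%N.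
    rewrite -PQR (leq_trans (size_polyD _ _)) // geq_max.
    have sq (p : {poly E}) : (size p <= n.+1)%N -> (size (p ^+ 2)%R <= (n + n).+1)%N.
      move=> sp; rewrite (leq_trans (size_exp_leq _ _)) // ltnS muln2 -addnn.
      by apply: leq_add; case: (size p) sp.
    by rewrite !sq.
  rewrite sR addnn -ltnS -doubleS ltn_double ltnS => h.
  by rewrite leq_double.
have Pn0 : P`_n != 0.
  apply: contraTneq nzn => Pn; move: PQn; rewrite Pn expr0n add0r => /eqP.
  by rewrite expf_eq0 /= => /eqP->; rewrite eqxx.
exists (Q`_n / P`_n); first by rewrite rpred_div ?(polyOverP _).
rewrite expr_div_n -[Q`_n ^+ 2](addKr (P`_n ^+ 2)) PQn addr0 mulNr divff //.
by rewrite expf_neq0.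
Qed.

(** In P^2 + Q^2 = sigma R^2 over A, compare the coefficients of the square of
the largest monomial m that occurs in P, Q or R. *)
Lemma two_squares_free (E : fieldType) (A : divringClosed E) n (t : 'I_n -> E)
    (sigma a b : E) :
  alg_independent (fun f => f \in A) t -> sigma \in A ->
  a \in madj A t -> b \in madj A t -> a ^+ 2 + b ^+ 2 = sigma ->
  exists a' b' c', [/\ a' \in A, b' \in A, c' \in A,
    [|| a' != 0, b' != 0 | c' != 0] & a' ^+ 2 + b' ^+ 2 = sigma * c' ^+ 2].
Proof.
move=> t_free sA /madjP[p1 [q1 [p1A q1A q10 aE]]] /madjP[p2 [q2 [p2A q2A q20 bE]]].
move=> e; pose P := p1 * q2; pose Q := p2 * q1; pose R := q1 * q2.
have PA : P \is a mpolyOver n A by rewrite rpredM.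
have QA : Q \is a mpolyOver n A by rewrite rpredM.
have RA : R \is a mpolyOver n A by rewrite rpredM.
have PQR : P * P + Q * Q - sigma *: (R * R) = 0.
  apply: t_free.
    apply/coefs_inP; rewrite rpredB ?rpredD ?rpredM //.
    by rewrite mpolyOverZ // rpredM.
  rewrite mevalB mevalD mevalZ !mevalM -!expr2.
  have := clear_denominators (sigma := sigma) (p1 := p1.@[t]) (p2 := p2.@[t]) (p3 := 1) q10 q20 (oner_neq0 E).
  rewrite divr1 expr1n mulr1 -aE -bE => /(_ e).
  by rewrite !mulr1 mul1r => ->; rewrite subrr.
have R0 : R != 0.
  apply: mulf_neq0; first by apply: contraNneq q10 => ->; rewrite meval0.
  by apply: contraNneq q20 => ->; rewrite meval0.
pose m := Order.max (mlead R) (Order.max (mlead P) (mlead Q)).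
have mR : (mlead R <= m)%O by rewrite !le_max lexx.
have mP : (mlead P <= m)%O by rewrite /m !le_max lexx orbT.
have mQ : (mlead Q <= m)%O by rewrite /m !le_max lexx !orbT.
have lead (p : {mpoly E[n]}) : m = mlead p -> (p@_m != 0) || (R@_m != 0).
  move=> mp; have [p0|p0] := eqVneq p 0; last by rewrite mp mleadc_eq0 p0.
  have m0 : m = 0%MM by rewrite mp p0 mlead0.
  have -> : m = mlead R by apply/le_anti; rewrite mR m0 le0x.
  by rewrite mleadc_eq0 R0 orbT.
exists P@_m, Q@_m, R@_m.
split; [exact: (mpolyOverP _ PA)|exact: (mpolyOverP _ QA)|
        exact: (mpolyOverP _ RA)| |].
  have : [\/ m = mlead R, m = mlead P | m = mlead Q].
    rewrite /m /Order.max; case: ifP => _; last by constructor 1.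
    by case: ifP => _; [constructor 3|constructor 2].
  by case=> /lead/orP[] ->; rewrite ?orbT.
have sq (p : {mpoly E[n]}) : (mlead p <= m)%O -> (p * p)@_(m + m) = p@_m ^+ 2.
  by move=> pm; rewrite mleadcMW.
have := congr1 (mcoeff (m + m)%MM) PQR.
rewrite mcoeffB mcoeffD mcoeffZ mcoeff0 !sq //.
by move=> /eqP; rewrite subr_eq0 => /eqP.
Qed.

(** * Cyclic groups of order four: rationality and its failure *)

Fact turn_ratio (K : fieldType) (r kappa z : K) :
  z ^+ 2 = -1 -> r != 0 -> r - z != 0 ->
  - kappa * ((- r^-1 + z) / (- r^-1 - z)) = kappa * ((r + z) / (r - z)).
Proof.
move=> z2 r0 rz; have z0 : z != 0.
  by apply: contra_eq_neq z2 => ->; rewrite expr0n eq_sym oppr_eq0 oner_eq0.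
have -> : - r^-1 + z = z * (r + z) / r.
  by rewrite mulrDr -expr2 z2; field.
have -> : - r^-1 - z = - (z * (r - z) / r).
  by rewrite mulrBr -expr2 z2; field.
by field; rewrite r0 rz oppr_eq0 mulf_neq0.
Qed.

Fact turn_ratio_inverse (K : fieldType) (r kappa z : K)
    (X := kappa * ((r + z) / (r - z))) :
  kappa != 0 -> r - z != 0 -> z != 0 -> (2 : K) != 0 ->
  r = z * (X / kappa + 1) / (X / kappa - 1).
Proof.
move=> k0 rz z0 two; have -> : X / kappa = (r + z) / (r - z).
  by rewrite /X mulrAC divff // mul1r.
have -> : (r + z) / (r - z) - 1 = 2 * z / (r - z) by field.
have -> : (r + z) / (r - z) + 1 = 2 * r / (r - z) by field.
by field; rewrite rz z0 two.
Qed.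

Fact turn_char2 (K : fieldType) (r m : K) : (2 : K) = 0 -> r != 0 ->
  r + 1 != 0 -> (- r^-1 + 1)^-1 + (1 - m) = (r + 1)^-1 + m.
Proof.
move=> two r0 r1; have opp (a : K) : - a = a.
  by apply/eqP; rewrite eq_sym -addr_eq0 -mulr2n -mulr_natl two mul0r.
rewrite !opp addrA; congr (_ + _).
have -> : (r^-1 + 1)^-1 = r / (r + 1).
  have -> : r^-1 + 1 = (r + 1) / r by field.
  by rewrite invf_div.
have -> : r / (r + 1) + 1 = (r + 1)^-1 + 2 * (r / (r + 1)) by field.
by rewrite two mul0r addr0.
Qed.

(** kappa^2 as a sum of two squares, whose terms are fixed by s according to
[turn_pythagoras]. *)
Fact pythagoras (K : fieldType) (r kappa : K) : r ^+ 2 + 1 != 0 ->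
  (kappa * ((r ^+ 2 - 1) / (r ^+ 2 + 1))) ^+ 2 +
  (kappa * (2 * r / (r ^+ 2 + 1))) ^+ 2 = kappa ^+ 2.
Proof. by move=> h; field. Qed.

Fact turn_pythagoras (K : fieldType) (r kappa : K) : r != 0 -> r ^+ 2 + 1 != 0 ->
  - kappa * (((- r^-1) ^+ 2 - 1) / ((- r^-1) ^+ 2 + 1)) =
    kappa * ((r ^+ 2 - 1) / (r ^+ 2 + 1)) /\
  - kappa * (2 * (- r^-1) / ((- r^-1) ^+ 2 + 1)) =
    kappa * (2 * r / (r ^+ 2 + 1)).
Proof.
move=> r0 h; rewrite sqrrN.
have -> : r^-1 ^+ 2 + 1 = (r ^+ 2 + 1) / r ^+ 2 by field.
by split; field; rewrite r0 h.
Qed.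

Fact neq_opp (K : fieldType) (a : K) : (2 : K) != 0 -> a != 0 -> a != - a.
Proof.
by move=> two a0; rewrite -subr_eq0 opprK -mulr2n -mulr_natl mulf_neq0.
Qed.

Section TurnRationality.
Variables (k : fieldType) (S : {group 'S_4}) (s : 'S_4) (i0 : 'I_4).
Local Notation x := (rvar k).
Local Notation K4 := (@Ginv k all_mx).
Local Notation K5 := (@Ginv k affine_mx).
Local Notation i1 := (s i0).
Local Notation i2 := (s i1).
Local Notation i3 := (s i2).
Hypotheses (Ss : S :=: <[s]>%g) (s4 : s i3 = i0) (kss : klein (s * s)%g).
Hypothesis q : quad i1 i0 i2 i3.
Local Notation mu := (mu k s i0).
Local Notation r0 := (half_ratio k s i0).

Let muK : mu \in K4. Proof. exact: mu_in. Qed.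
Let rT : transc K4 r0. Proof. exact: half_ratio_transc. Qed.
Let rK : r0 \in K5. Proof. exact: half_ratio_in. Qed.
Let rn0 : r0 != 0. Proof. exact: half_ratio_neq0. Qed.
Let pr : pact k s r0 = - r0^-1. Proof. exact: pact_half_ratio. Qed.
Let pmu : pact k s mu = 1 - mu. Proof. exact: pact_mu. Qed.

(** An element of K4 that s maps to its opposite. *)
Definition kappa := 1 - 2 * mu.

Lemma kappa_neq0 : kappa != 0.
Proof. have [_ _ h _] := cross_ratio_transc_cond k q; exact: h. Qed.

Lemma kappa_in : kappa \in K4.
Proof.
by apply: rpredB; [exact: rpred1|apply: rpredM => //; exact: rpred_nat].
Qed.

Lemma pact_kappa : pact k s kappa = - kappa.
Proof.
rewrite rmorphB rmorph1 rmorphM rmorph_nat [X in 1 - 2 * X]pmu /kappa.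
by move: mu => m; ring.
Qed.

Lemma two_neq0 : (2 : k) != 0 -> (2 : ratfun4 k) != 0.
Proof. by rewrite -(rmorph_nat (@rconst k)) fmorph_eq0. Qed.

(** The homography (r + z) / (r - z) turns the involution r -> -1/r into a
change of sign, which kappa compensates. *)
Lemma rational_of_root (z : k) : z ^+ 2 = -1 -> (2 : k) != 0 ->
  rational_over (L4fix k S) (K4fix k S).
Proof.
move=> z2 /two_neq0 two; pose Z := rconst z.
have Z2 : Z ^+ 2 = -1 by rewrite -rmorphXn z2 rmorphN1.
have ZK : Z \in K4 by apply: Ginv_const.
have Z0 : Z != 0.
  by apply: contra_eq_neq Z2 => ->; rewrite expr0n eq_sym oppr_eq0 oner_eq0.
have rZ : r0 - Z != 0 by rewrite subr_eq0; apply: transc_notin rT ZK.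
have kK := kappa_in; have k0 := kappa_neq0.
pose X := kappa * ((r0 + Z) / (r0 - Z)).
have KK := @Ginv_all_affine k.
apply: (@rational_of_turn k S s i0 Ss s4 kss q X).
- apply: rpredM; first exact: KK.
  by apply: rpred_div; [apply: rpredD|apply: rpredB] => //; apply: KK.
- rewrite /X rmorphM pact_kappa fmorph_div rmorphB rmorphD pr.
  have -> : pact k s Z = Z by apply: perm_act_const.
  exact: (turn_ratio kappa Z2 rn0 rZ).
- have -> : r0 = Z * (X / kappa + 1) / (X / kappa - 1).
    exact: (turn_ratio_inverse k0 rZ Z0 two).
  have XA : X \in adj K4 X by apply: adj_gen.
  have kA : kappa \in adj K4 X by apply: adj_sub.
  have ZA : Z \in adj K4 X by apply: adj_sub.
  have XkA : X / kappa \in adj K4 X by apply: rpred_div.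
  have oneA : 1 \in adj K4 X by apply: rpred1.
  apply: rpred_div; last exact: rpredB.
  by apply: rpredM => //; apply: rpredD.
Qed.

(** In characteristic two the involution r -> 1/r has the fixed point 1, and
1 / (r + 1) is translated by 1; so is mu. *)
Lemma rational_of_char2 : (2 : k) = 0 -> rational_over (L4fix k S) (K4fix k S).
Proof.
move=> two_k; have two : (2 : ratfun4 k) = 0.
  by rewrite -(rmorph_nat (@rconst k)) two_k rmorph0.
have r1 : r0 + 1 != 0.
  by rewrite addr_eq0; apply: transc_notin rT _; rewrite rpredN rpred1.
pose X := (r0 + 1)^-1 + mu; have KK := @Ginv_all_affine k.
apply: (@rational_of_turn k S s i0 Ss s4 kss q X).
- apply: rpredD; last exact: KK.
  by rewrite rpredV; apply: rpredD => //; apply: rpred1.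
- rewrite /X rmorphD fmorphV rmorphD rmorph1 pr [X in _ + X = _]pmu.
  exact: (turn_char2 mu two rn0 r1).
- have -> : r0 = (X - mu)^-1 - 1 by rewrite /X addrK invrK addrK.
  apply: rpredB; last exact: rpred1.
  rewrite rpredV; apply: rpredB; first exact: adj_gen.
  exact: adj_sub.
Qed.

Lemma movable_kappa : (2 : k) != 0 -> movable (@kconst k) kappa.
Proof.
move=> /two_neq0 two; have -> : kappa = (- 2) * mu + 1 by rewrite mulNr addrC.
apply: movable_affine; rewrite ?rpredN ?rpred1 ?rpred_nat ?oppr_eq0 //.
exact: movable_cross_ratio.
Qed.

Lemma kappa_sq_poly (A : divringClosed (ratfun4 k)) : kappa ^+ 2 \in A ->
  'X^2 - (kappa ^+ 2)%:P \is a polyOver A.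
Proof.
by move=> kA; apply: rpredB; [rewrite rpredX ?polyOverX|rewrite polyOverC].
Qed.

Lemma kappa_sq_root : ('X^2 - (kappa ^+ 2)%:P).[kappa] = 0.
Proof. by rewrite hornerD hornerN hornerXn hornerC subrr. Qed.

(** K4 = k(kappa) and s changes the sign of kappa. *)
Lemma kappa_sq_generates f : (2 : k) != 0 -> f \in K4 -> pact k s f = f ->
  f \in adj (@kconst k) (kappa ^+ 2).
Proof.
move=> /two_neq0 two fK sf; have k2A := adj_gen (@kconst k) (kappa ^+ 2).
apply: (@fixed_simple_ext _ _ ('X^2 - (kappa ^+ 2)%:P) kappa _ (pact k)
  [:: 1%g; s]).
- exact: kappa_sq_poly.
- exact: monicXnsubC.
- exact: kappa_sq_root.
- exact: size_XnsubC.
- move=> n ns; have nf : pact k n f = f.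
    by move: ns; rewrite !inE => /pred2P[]-> //; apply: (@perm_act1 k).
  split=> //; apply: (adj_agree (f := pact k n) (g := idfun)) => [c|].
    by move=> /asboolP[a ->]; apply: (@perm_act_const k).
  move: ns; rewrite !inE rmorphXn => /pred2P[]->.
    by congr (_ ^+ _); apply: (@perm_act1 k).
  by rewrite [X in X ^+ _]pact_kappa sqrrN.
- rewrite /= inE andbT [X in X != _](@perm_act1 k) pact_kappa.
  exact: (neq_opp two kappa_neq0).
have [K4A _ _ _] := invariant_tower k q.
apply: adj_min (K4A f fK) => [c cA|]; first by do 2 apply: adj_sub.
have -> : cross_ratio x i1 i0 i2 i3 = (1 - kappa) / 2.
  by rewrite /kappa opprB addrC subrK mulrC mulKf.
apply: rpred_div; last exact: rpred_nat.
by apply: rpredB; [exact: rpred1|exact: adj_gen].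
Qed.

(** kappa^2 is a sum of two squares in E^S; rationality brings this down to
K4^S = k(kappa^2), up to a common denominator. *)
Lemma root_of_rational : (2 : k) != 0 ->
  rational_over (L4fix k S) (K4fix k S) -> exists z : k, z ^+ 2 = -1.
Proof.
move=> two [n [t [t_free tP]]].
have k0 := kappa_neq0; have kK := kappa_in.
have r1 : r0 ^+ 2 + 1 != 0.
  apply/eqP => e; have : 'X^2 - (- 1)%:P = 0 :> {poly ratfun4 k}.
    apply: rT; last by rewrite hornerD hornerN hornerXn hornerC opprK.
    apply: rpredB; first by rewrite rpredX ?polyOverX.
    by rewrite polyOverC rpredN rpred1.
  by move/eqP; rewrite -size_poly_eq0 size_XnsubC.
pose a := kappa * ((r0 ^+ 2 - 1) / (r0 ^+ 2 + 1)).
pose b := kappa * (2 * r0 / (r0 ^+ 2 + 1)).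
have [sa sb] := turn_pythagoras kappa rn0 r1.
have L_in f : pact k s f = f -> f \in madj (fixp K4 (pact k) S) t.
  move=> sf; have /tP[p [p' [pK pK' p0 e]]] : L4fix k S f.
    by move=> u uS; apply: (pact_cycle Ss sf uS).
  by apply/asboolP; exists p, p'; split=> // m; apply/K4fixP.
have aL : a \in madj (fixp K4 (pact k) S) t.
  apply: L_in; rewrite -[RHS]sa rmorphM pact_kappa fmorph_div rmorphB rmorphD.
  by rewrite rmorphXn rmorph1 pr.
have bL : b \in madj (fixp K4 (pact k) S) t.
  apply: L_in; rewrite -[RHS]sb rmorphM pact_kappa fmorph_div rmorphM rmorph_nat pr.
  by rewrite rmorphD rmorphXn rmorph1 pr.
have k2 : kappa ^+ 2 \in fixp K4 (pact k) S.
  apply/fixpP; split=> [|u uS]; first exact: rpredX.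
  by apply: (pact_cycle Ss _ uS); rewrite rmorphXn pact_kappa sqrrN.
have t_free' : alg_independent (fun f => f \in fixp K4 (pact k) S) t.
  by move=> p pK; apply: t_free => m; apply/K4fixP.
have [a' [b' [c' [aK bK cK nz e]]]] :=
  two_squares_free t_free' k2 aL bL (pythagoras kappa r1).
have inA f : f \in fixp K4 (pact k) S -> f \in adj (@kconst k) (kappa ^+ 2).
  move=> /fixpP[fK fS]; apply: kappa_sq_generates => //; apply: fS.
  by rewrite Ss cycle_id.
have k2T : transc (@kconst k) (kappa ^+ 2).
  apply: movable_alg (movable_kappa two) _ _ kappa_sq_root.
    exact/kappa_sq_poly/adj_gen.
  by rewrite -size_poly_eq0 size_XnsubC.
have [w /asboolP[z ->]] :=
  two_squares_transc k2T (inA _ aK) (inA _ bK) (inA _ cK) nz e.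
move=> z2; exists z; apply: (fmorph_inj (@rconst k)).
by rewrite rmorphXn z2 rmorphN1.
Qed.

End TurnRationality.

Lemma primitive_root4P (k : fieldType) (z : k) : (2 : k) != 0 ->
  4.-primitive_root z <-> z ^+ 2 = -1.
Proof.
move=> two; split=> [zP|z2].
  have := prim_expr_order zP; rewrite -[4%N]/(2 * 2)%N exprM => /eqP.
  rewrite sqrf_eq1 -(prim_order_dvd zP) /=.
  by move=> /eqP.
have neq1 : (-1 : k) != 1.
  by rewrite eq_sym -subr_eq0 opprK -mulr2n.
have z3 : z ^+ 3 = - z by rewrite exprS z2 mulrN1.
have z4 : z ^+ 4 = 1 by rewrite -[4%N]/(2 * 2)%N exprM z2 sqrrN expr1n.
have z1 : z != 1 by apply: contra_eq_neq z2 => ->; rewrite expr1n eq_sym.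
have zN1 : - z != 1.
  by apply: contra_eq_neq z2 => /(canRL opprK)->; rewrite sqrrN expr1n eq_sym.
apply/andP; split=> //; apply/forallP => -[[|[|[|[|i]]]] Hi] //=.
- by rewrite unity_rootE expr1 (negPf z1).
- by rewrite unity_rootE z2 (negPf neq1).
- by rewrite unity_rootE z3 (negPf zN1).
- by rewrite unity_rootE z4 !eqxx.
Qed.

Theorem theorem3 (k : fieldType) (S : {group 'S_4}) :
  [/\ ~ (cyclic S /\ #|S| = 4%N) ->
        rational_over (L4fix k S) (K4fix k S),
      cyclic S -> #|S| = 4%N -> 2%N \notin [pchar k] ->
        (rational_over (L4fix k S) (K4fix k S) <->
         exists z : k, 4.-primitive_root z)
    & cyclic S -> #|S| = 4%N -> 2%N \in [pchar k] ->
        rational_over (L4fix k S) (K4fix k S)].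
Proof.
split=> [/klein_orbit_or_cyclic4[i iP]|cS S4|cS S4].
- exact: rational_of_orbit iP.
- rewrite inE /= => two; have [s [i [Ss s4 kss q]]] := cyclic4_turn cS S4.
  split=> [/(root_of_rational Ss s4 q two)[z z2]|[z]].
    by exists z; apply/primitive_root4P.
  move=> /(primitive_root4P _ two) z2; exact: (rational_of_root Ss s4 kss q z2 two).
- rewrite inE /= => /eqP two; have [s [i [Ss s4 kss q]]] := cyclic4_turn cS S4.
  exact: (rational_of_char2 Ss s4 kss q two).
Qed.
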